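(* Let $0 < k < n$ be an integer, $p >1$ and let $w \in C_0(\mathcal{G}_{n-k,n}) \cap L^1(\mathcal{G}_{n-k,n})$ be non-negative. Let $g\in C_0(\mathcal{G}_{n-k,n}) \cap L^p(\mathcal{G}_{n-k,n},w)$ be such that $\beta e^{-\alpha |z|_2^2} \leq g(H,z) \leq \gamma e^{-\alpha |z|_2^2}$ holds for every $H \in G_{n-k,n}$ and $z \in H^\perp$, where $\alpha,\beta,\gamma >0$. Then \[ \|g\|_{L^p(\mathcal{G}_{n-k,n},w)} \leq \left(\frac{\gamma}{\beta}\right)^{p-1} \left\|\frac{\mathcal{R}_{n-k}^*[gw]}{\mathcal{R}_{n-k}^*w}\right\|_{L^\infty(\mathbb{R}^n)}\|w\|_{L^1(\mathcal{G}_{n-k,n})}^{\frac{1}{p}}. \]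
   Context: $G_{n-k,n}$ is the Grassmannian of $(n-k)$-dimensional linear subspaces of $\mathbb{R}^n$ with Haar measure $\nu_{n-k}$ of total mass $|S^{k-1}||S^{n-k-1}|/|S^{n-1}|$. $\mathcal{G}_{n-k,n}$ is the manifold of $(n-k)$-dimensional affine subspaces of $\mathbb{R}^n$; its elements are written $(H,z)$, with $H\in G_{n-k,n}$, $z\in H^\perp$, representing $H+z$. $C_0$ denotes real-valued continuous functions vanishing at infinity. For $w\ge0$, $\|g\|_{L^p(\mathcal{G}_{n-k,n},w)}=\left(\int_{G_{n-k,n}}\int_{H^\perp}|g(H,z)|^p\,w(H,z)\,dz\,d\nu_{n-k}(H)\right)^{1/p}$, and $L^p(\mathcal{G}_{n-k,n})$ corresponds to $w\equiv1$. $|\cdot|_2$ is the Euclidean norm. The dual $(n-k)$-dimensional Radon transform is $\mathcal{R}_{n-k}^*\psi(x)=\int_{G_{n-k,n}}\psi(H,P_{H^\perp}(x))\,d\nu_{n-k}(H)$, $x\in\mathbb{R}^n$, with $P_{H^\perp}$ the orthogonal projection onto $H^\perp$. Convention for the quotient: $0/0:=0$ (here $\mathcal{R}_{n-k}^*[gw](x)=0$ whenever $\mathcal{R}_{n-k}^*w(x)=0$). *)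

(* Defs.v *)
From HB Require Import structures.
From mathcomp Require Import all_boot all_order all_algebra.
From mathcomp Require Import all_classical all_reals all_analysis.
From mathcomp Require Import lra.

Set Implicit Arguments.
Unset Strict Implicit.
Unset Printing Implicit Defensive.

Import Order.TTheory GRing.Theory Num.Theory.
Import numFieldNormedType.Exports.

Local Open Scope classical_set_scope.
Local Open Scope ring_scope.

Notation borel T := (g_sigma_algebraType (@open T)).

Section euclidean.
Context {R : realType} {n : nat}.
Implicit Types (x u v z : 'rV[R]_n) (H : {vspace 'rV[R]_n}).

Definition dotr u v : R := \sum_i u 0 i * v 0 i.

(* The library norm on ['rV[R]_n] is the sup norm. *)
Definition enorm x : R := Num.sqrt (dotr x x).

Definition perp H : set 'rV[R]_n := [set z | forall u, u \in H -> dotr z u = 0].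

Definition perp_proj H x : 'rV[R]_n :=
  xget 0 [set z | perp H z /\ x - z \in H].

Lemma dotrE u v : dotr u v = (u *m v^T) 0 0.
Proof. by rewrite mxE; apply: eq_bigr => i _; rewrite mxE. Qed.

Lemma dotr_eq0 u : dotr u u = 0 -> u = 0.
Proof.
move=> u0; apply/rowP => i; rewrite mxE; apply/eqP.
have uu_ge0 j : true -> 0 <= u 0 j * u 0 j by rewrite -expr2 sqr_ge0.
by have /(_ i isT)/eqP := psumr_eq0P uu_ge0 u0; rewrite mulf_eq0 orbb.
Qed.

Lemma perp_decomposition H x : exists z, perp H z /\ x - z \in H.
Proof.
pose B : 'M[R]_(\dim H, n) := \matrix_i (vbasis H)`_i.
have mulB (c : 'rV_(\dim H)) : c *m B = \sum_i c 0 i *: (vbasis H)`_i.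
  by rewrite mulmx_sum_row; apply: eq_bigr => i _; rewrite rowK.
have BH (c : 'rV_(\dim H)) : c *m B \in H.
  rewrite mulB; apply: memv_suml => i _; apply: memvZ; apply: vbasis_mem.
  by rewrite mem_nth// size_tuple.
have Binj (c : 'rV_(\dim H)) : c *m B = 0 -> c = 0.
  rewrite mulB => c0; apply/rowP => i; rewrite mxE.
  by have /freeP := basis_free (vbasisP H); apply; exact: c0.
have GU : B *m B^T \in unitmx.
  rewrite -row_free_unit -kermx_eq0; apply/eqP/row_matrixP => i.
  rewrite row0; apply: Binj; apply: dotr_eq0.
  rewrite dotrE trmx_mul !mulmxA -(mulmxA _ B) -row_mul mulmx_ker row0 mul0mx.
  by rewrite mxE.
exists (x - x *m B^T *m invmx (B *m B^T) *m B); split; last first.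
  by rewrite subKr BH.
move=> u uH; have -> : u = (\row_i coord (vbasis H) i u) *m B.
  by rewrite mulB {1}(coord_vbasis uH); apply: eq_bigr => i _; rewrite mxE.
rewrite dotrE trmx_mul mulmxA mulmxBl -(mulmxA _ B) mulmxKV// subrr mul0mx.
by rewrite mxE.
Qed.

Lemma perp_perp_proj H x : perp H (perp_proj H x).
Proof. by have [] := xgetPex 0 (perp_decomposition H x). Qed.

End euclidean.

Section lebesgue.
Context {R : realType}.

(* [R^(n+1)] is read as [R^n x R]: the last factor becomes coordinate 0. *)
Definition row_cons n (y : borel 'rV[R]_n * measurableTypeR R) :
  borel 'rV[R]_n.+1 := row_mx (y.2%:M : 'M[R]_1) (y.1 : 'rV[R]_n).

Lemma measurable_row_cons n :
  measurable_fun [set: borel 'rV[R]_n * measurableTypeR R] (@row_cons n).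
Proof.
apply: (@measurability _ _ _ (borel 'rV[R]_n.+1) _ _ (@open 'rV[R]_n.+1)) => //.
move=> _ [U oU <-]; rewrite setTI.
pose T : Type := ('rV[rat]_n.+1 * rat)%type.
pose box (q : T) : set 'rV[R]_n.+1 :=
  ball (map_mx (ratr : rat -> R) q.1 : 'rV[R]_n.+1) (ratr q.2 : R).
pose F (q : T) := [set y | 0 < ratr q.2 :> R /\ box q `<=` U /\
  box q (@row_cons n y)].
have -> : @row_cons n @^-1` U = \bigcup_q F q.
  apply/seteqP; split=> [y /= Uy|y [q _ [_ [qU qy]]]]; last exact: qU.
  have /nbhs_ballP[e /= e0 eU] := open_nbhs_nbhs (conj oU Uy).
  have [r] := rat_in_itvoo (divr_gt0 e0 (ltr0n R 2)).
  rewrite in_itv/= => /andP[r0 re].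
  set x : 'rV[R]_n.+1 := row_cons y in Uy eU *.
  have qx j : exists q : rat, ball (ratr q : R) (ratr r) (x 0 j).
    have [q] : exists q : rat, ratr q \in `]x 0 j - ratr r, x 0 j + ratr r[%R.
      by apply: rat_in_itvoo; rewrite ltrD2l; lra.
    rewrite in_itv/= => /andP[h1 h2]; exists q; rewrite /ball/= ltr_distl.
    by apply/andP; split; lra.
  have [c cx] := choice qx.
  have bx : box (\row_j c j, r) x.
    by split=> [|i j]; [exact: r0|rewrite ord1 mxE mxE; exact: cx].
  exists (\row_j c j, r) => //; split=> //; split=> // z bz; apply: eU.
  apply: (@le_ball _ _ _ (ratr r + ratr r)); first by lra.
  by apply: ball_triangle bz; exact: ball_sym.
apply: countable_bigcupT_measurable => [|[c r]]; first exact: countableP.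
have [r0|] := boolP (0 < ratr r :> R); last first.
  move=> r0; rewrite (_ : F _ = set0)//; apply/seteqP; split=> y //=.
  by move=> [/= h]; rewrite h in r0.
have [cU|cU] := pselect (box (c, r) `<=` U); last first.
  by rewrite (_ : F _ = set0)//; apply/seteqP; split=> y //= [_ []].
rewrite (_ : F _ = (ball (map_mx (ratr : rat -> R) (rsubmx (c : 'rV_(1 + n))) : 'rV[R]_n) (ratr r)
   : set (borel 'rV[R]_n)) `*` (ball (ratr (c 0 0) : R) (ratr r)
   : set (measurableTypeR R))).
  apply: measurableX; last exact: measurable_realfun.measurable_ball.
  by apply: sub_sigma_algebra; exact: ball_open.
apply/seteqP; split=> -[y t] /=.
  move=> [_ [_ [_ /= yt]]]; split.
    split=> // i j; have := yt 0 (rshift 1 j).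
    by rewrite /row_cons (@row_mxEr _ 1 1 n) !mxE ord1.
  have := yt 0 (lshift n (0 : 'I_1)).
  rewrite /row_cons (@row_mxEl _ 1 1 n) !mxE eqxx mulr1n.
  by rewrite (_ : lshift n 0 = 0)//; apply: val_inj.
move=> [[_ yb] tb]; split=> //; split=> //; split=> // i j.
rewrite ord1; case: (split_ordP (j : 'I_(1 + n))) => [j' ->|j' ->].
  rewrite /row_cons (@row_mxEl _ 1 1 n) !mxE !ord1 eqxx mulr1n.
  by rewrite (_ : lshift n 0 = 0)//; apply: val_inj.
by rewrite /row_cons (@row_mxEr _ 1 1 n); have := yb 0 j'; rewrite !mxE.
Qed.

Definition lebesgueRnS n (mu : {measure set (borel 'rV[R]_n) -> \bar R}) :
    {measure set (borel 'rV[R]_n.+1) -> \bar R} :=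
  measure_function_pushforward__canonical__measure_function_Measure
    (mu \x @lebesgue_measure R)%E (@measurable_row_cons n).

Fixpoint lebesgueRn n : {measure set (borel 'rV[R]_n) -> \bar R} :=
  if n is m.+1 then lebesgueRnS (lebesgueRn m)
  else \d_(0 : borel 'rV[R]_0).

(* [sphere_area m] is |S^(m-1)|, the total mass of the cone measure
   [A |-> m vol {r u | u in A, 0 < r <= 1}] on the unit sphere of R^m; in
   particular [sphere_area 1 = 2]. *)
Definition sphere_area m : R :=
  m%:R * fine (lebesgueRn m [set x | enorm x <= 1]).

End lebesgue.
Arguments lebesgueRn R n : clear implicits.
Arguments sphere_area R m : clear implicits.

Section grassmannian.
Variables (R : realType) (n k : nat).

(* G_{n-k,n}: the parameter [k] is the codimension. *)
Definition codim_subspace := {H : {vspace 'rV[R]_n} | \dim H == (n - k)%N}.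

(* Matrix, acting on row vectors, of the orthogonal projection onto the
   orthogonal complement of [H]. *)
Definition proj_mx (H : codim_subspace) : 'M[R]_n :=
  lin1_mx (perp_proj (val H)).

Lemma codim_subspace_ex : exists H : {vspace 'rV[R]_n}, \dim H == (n - k)%N.
Proof.
exists <<take (n - k) (vbasis (fullv : {vspace 'rV[R]_n}))>>%VS.
have := basis_free (vbasisP (fullv : {vspace 'rV[R]_n})).
rewrite -{1}(cat_take_drop (n - k) (vbasis _)) => /catl_free/eqP ->.
rewrite size_takel// size_tuple dimvf /dim/= mul1n.
exact: leq_subr.
Qed.

HB.instance Definition _ := Choice.on codim_subspace.
HB.instance Definition _ := isPointed.Build codim_subspace
  (exist _ (projT1 (cid codim_subspace_ex)) (projT2 (cid codim_subspace_ex))).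

(* The usual (compact manifold) topology of the Grassmannian is the one that
   makes [H |-> proj_mx H] an embedding. *)
Definition grass := initial_topology proj_mx.
HB.instance Definition _ := Topological.copy grass (initial_topology proj_mx).
HB.instance Definition _ := Pointed.copy grass codim_subspace.

Coercion grass_vspace (H : grass) : {vspace 'rV[R]_n} := sval H.

(* Pairs [(H, z)] with [z] orthogonal to [H], standing for the affine subspace
   [H + z]; as a type, [affgrass] carries the topology induced by the product
   topology. *)
Definition affgrass : set (grass * 'rV[R]_n) :=
  [set a : grass * 'rV[R]_n | perp (grass_vspace a.1) a.2].

(* The affine subspace [H + x], for an arbitrary [x]; it is the pair [(H, x)]
   when [x] is orthogonal to [H]. *)
Definition aff (H : grass) (x : 'rV[R]_n) : affgrass :=
  exist _ (H, perp_proj H x) (mem_set (@perp_perp_proj R n H x)).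

Definition vanishes_at_infinity (g : affgrass -> R) :=
  forall e, 0 < e ->
    exists2 K : set affgrass, compact K & forall a, ~ K a -> `|g a| < e.

Definition C0 (g : affgrass -> R) := continuous g /\ vanishes_at_infinity g.

(* The Haar measure is the O(n)-invariant Borel measure of the given total
   mass; the matrix [Q] acts on a subspace by [u |-> u *m Q]. *)
Record is_haar (nu : {measure set (borel grass) -> \bar R}) : Prop := {
  haar_mass : nu [set: borel grass] =
    (sphere_area R k * sphere_area R (n - k) / sphere_area R n)%:E ;
  haar_invariant : forall Q : 'M[R]_n, Q *m Q^T = 1%:M ->
    forall A : set (borel grass), measurable A ->
      nu [set K : borel grass | exists2 H : grass, A H &
            grass_vspace K = (linfun (mulmxr Q) @: grass_vspace H)%VS] = nu A }.

(* An orthonormal basis of the orthogonal complement of [H], as the rows of a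
   matrix. *)
Definition perp_frame (H : grass) : 'M[R]_(k, n) :=
  xget 0 [set B : 'M[R]_(k, n) | B *m B^T = 1%:M /\
                                 forall z, (z <= B)%MS <-> perp H z].

(* Integral against k-dimensional Lebesgue measure on the orthogonal
   complement of [H], transported from R^k by a linear isometry; it does not
   depend on the choice of the frame. *)
Definition integral_perp (H : grass) (f : 'rV[R]_n -> \bar R) : \bar R :=
  (\int[lebesgueRn R k]_y f ((y : 'rV[R]_k) *m perp_frame H))%E.

Variable nu : {measure set (borel grass) -> \bar R}.

Definition aff_Lnorm (p : R) (w g : affgrass -> R) : \bar R :=
  ((\int[nu]_H integral_perp H
      (fun z => (`|g (aff H z)| `^ p * w (aff H z))%:E)) `^ p^-1)%E.

Definition dual_radon (psi : affgrass -> R) (x : 'rV[R]_n) : R :=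
  \int[nu]_H psi (aff H x).

(* Division by zero in the field [R] yields 0, so that 0/0 = 0. *)
Definition radon_quotient (g w : affgrass -> R) (x : 'rV[R]_n) : R :=
  dual_radon (g \* w) x / dual_radon w x.

End grassmannian.
Arguments affgrass R n k : clear implicits.

(* Main.v *)
Require Import Defs.
From HB Require Import structures.
From mathcomp Require Import all_boot all_order all_algebra.
From mathcomp Require Import all_classical all_reals all_analysis.
From mathcomp Require Import measurable_realfun ess_sup_inf ring lra.

Set Implicit Arguments.
Unset Strict Implicit.
Unset Printing Implicit Defensive.

Import Order.TTheory GRing.Theory Num.Theory.
Import numFieldNormedType.Exports.

Local Open Scope classical_set_scope.
Local Open Scope ring_scope.

(** Put [b = alpha (p - 1)] and let [P_H x] be the projection of [x] onto the
    orthogonal complement of [H].  The upper bound on [g] gives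
    [g^p <= gamma^(p-1) g e^(-b |z|^2)], so [||g||_p^p] is at most
    [gamma^(p-1)] times the integral of [g w e^(-b |z|^2)] over affine
    subspaces.  The dual transform of the Gaussian [e^(-b |x|^2)] of R^n is a
    constant multiple of [e^(-b |z|^2)], so by Tonelli this integral is, up to
    that constant, the integral of [R*(g w)(x) e^(-b |x|^2)] over R^n.  Bounding
    [R*(g w)] by [M R*w], with [M] the sup norm of the quotient, and going back
    with the lower bound on [g] yields
    [||g||_p^p <= (gamma/beta)^(p-1) M int g^(p-1) w]; Hoelder's inequality and
    a division by [||g||_p^(p-1)] conclude.

    The arbitrary choice of frames in [integral_perp] is never integrated in
    [H]: for each [H], the integral of [F] over the orthogonal complement of [H]
    is rewritten as a multiple of the integral over R^n of
    [F (P_H x) e^(-b |x - P_H x|^2)], which is jointly measurable in [(H, x)].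
    This uses the rotation invariance of Lebesgue measure on R^n. *)

(** * Second countability and Borel measurability of continuous maps *)

(** The base consists of balls with rational centre and rational radius. Halving the available
    radius [e] leaves room for the triangle inequality. *)
Lemma second_countable_mx (R : realType) m n : @second_countable 'M[R]_(m, n).
Proof.
pose box (q : 'M[rat]_(m, n) * rat) : set 'M[R]_(m, n) :=
  ball (map_mx (ratr : rat -> R) q.1 : 'M[R]_(m, n)) (ratr q.2 : R).
exists (range box).
  exact: sub_countable (card_image_le _ _) (countableP _).
split=> [_ [q _ <-]|x U]; first exact: ball_open.
move=> /nbhs_ballP[e /= e0 eU].
have [r] := rat_in_itvoo (divr_gt0 e0 (ltr0n R 2)).
rewrite in_itv/= => /andP[r0 re].
have qx ij : exists q : rat, ball (ratr q : R) (ratr r) (x ij.1 ij.2).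
  have [q] : exists q : rat, ratr q \in
      `]x ij.1 ij.2 - ratr r, x ij.1 ij.2 + ratr r[%R.
    by apply: rat_in_itvoo; rewrite ltrD2l; lra.
  rewrite in_itv/= => /andP[h1 h2]; exists q; rewrite /ball/= ltr_distl.
  by apply/andP; split; lra.
have [c cx] := choice qx.
have bx : box (\matrix_(i, j) c (i, j), r) x.
  by split=> // i j; rewrite !mxE; exact: (cx (i, j)).
exists (box (\matrix_(i, j) c (i, j), r)).
  by split=> //; exists (\matrix_(i, j) c (i, j), r).
move=> y yb; apply: eU; apply: (@le_ball _ _ _ (ratr r + ratr r)); first by lra.
by apply: ball_triangle yb; exact: ball_sym.
Qed.

Lemma second_countable_initial (S : choiceType) (T : topologicalType)
  (f : S -> T) : @second_countable T -> @second_countable (initial_topology f).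
Proof.
move=> [B Bcount [Bo Bb]]; exists ((fun A => f @^-1` A) @` B).
  exact: sub_countable (card_image_le _ _) Bcount.
split=> [_ [A BA <-]|x U]; first by exists A => //; exact: Bo.
move=> -[_ [[V oV <-] /= Vx VU]].
have [A [BA Ax] AV] := Bb (f x) V (open_nbhs_nbhs (conj oV Vx)).
exists (f @^-1` A); first by split=> //; exists A.
by move=> y Ay; apply: VU; exact: AV.
Qed.

Lemma continuous_borel_measurable (R : realType) (T : ptopologicalType)
  (f : T -> R) : continuous f -> measurable_fun [set: borel T] (f : borel T -> R).
Proof.
move=> /continuousP cf.
apply: measurability; first exact: RGenOpens.measurableE.
move=> _ [_ [a [b ->]] <-]; rewrite setTI; apply: sub_sigma_algebra; apply: cf; exact: interval_open.
Qed.

Lemma continuous_borel_borel (S T : ptopologicalType) (f : S -> T) :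
  continuous f -> measurable_fun [set: borel S] (f : borel S -> borel T).
Proof.
move=> /continuousP cf.
apply: (@measurability _ _ _ (borel T) _ _ (@open T)) => //.
by move=> _ [U oU <-]; rewrite setTI; apply: sub_sigma_algebra; exact: cf.
Qed.

(** Products carry the product sigma-algebra. An open set belongs to it because it is the union of
    the basic rectangles it contains, and these are countably many. Joint continuity therefore gives
    joint measurability, as Tonelli requires. *)
Lemma open_measurable_prod (S T : ptopologicalType) :
  @second_countable S -> @second_countable T ->
  forall U : set (S * T), open U -> measurable (U : set (borel S * borel T)).
Proof.
move=> [A Ac [Ao Ab]] [B Bc [Bo Bb]] U oU.
(* Rectangles not contained in [U] are replaced by the empty set, so the union may run over all
   pairs of basic sets. *)
pose F (q : set S * set T) : set (borel S * borel T) :=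
  if `[< q.1 `*` q.2 `<=` U >] then q.1 `*` q.2 else set0.
have -> : U = \bigcup_(q in A `*` B) F q :> set (S * T).
  apply/seteqP; split=> [[x y] Uxy|[x y] [q _]]; last first.
    by rewrite /F; case: asboolP => // qU; exact: qU.
  have [[X Y] [Xx Yy] XYU] := open_nbhs_nbhs (conj oU Uxy).
  have [X' [AX' X'x] X'X] := Ab _ _ Xx.
  have [Y' [BY' Y'y] Y'Y] := Bb _ _ Yy.
  exists (X', Y') => //; rewrite /F asboolT//= => -[a b] [/= a' b'].
  by apply: XYU; split; [exact: X'X|exact: Y'Y].
rewrite bigcup_set_type; apply: countable_bigcupT_measurable.
  by rewrite (eq_countable (card_setT _)); exact: countableX.
move=> [[X Y] /= /set_mem[/= AX BY]]; rewrite /F; case: asboolP => //= _.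
by apply: measurableX; apply: sub_sigma_algebra; [exact: Ao|exact: Bo].
Qed.

Lemma continuous_prod_measurable (R : realType) (S T : ptopologicalType)
  (f : S * T -> R) : @second_countable S -> @second_countable T ->
  continuous f -> measurable_fun [set: borel S * borel T] (f : borel S * borel T -> R).
Proof.
move=> cS cT /continuousP cf.
apply: measurability; first exact: RGenOpens.measurableE.
move=> _ [_ [a [b ->]] <-]; rewrite setTI; apply: open_measurable_prod => //; apply: cf; exact: interval_open.
Qed.

Lemma continuous_prod_borel (S T U : ptopologicalType)
  (f : S * T -> U) : @second_countable S -> @second_countable T ->
  continuous f ->
  measurable_fun [set: borel S * borel T] (f : borel S * borel T -> borel U).
Proof.
move=> cS cT /continuousP cf.
apply: (@measurability _ _ _ (borel U) _ _ (@open U)) => //.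
by move=> _ [V oV <-]; rewrite setTI; apply: open_measurable_prod => //; exact: cf.
Qed.

Lemma mx_continuous (T : topologicalType) (K : numFieldType) m n
    (f : T -> 'M[K]_(m, n)) :
  (forall i j, continuous (fun x => f x i j)) -> continuous f.
Proof.
move=> cf x; apply/cvg_ballP => e e0.
have : \forall y \near x, forall ij : 'I_m * 'I_n,
    ball (f x ij.1 ij.2) e (f y ij.1 ij.2).
  apply: filter_forall => ij.
  by have /cvg_ballP := cf ij.1 ij.2 x; exact.
by apply: filterS => y xy; split=> // i j; exact: (xy (i, j)).
Qed.

Lemma continuous_mulmx (T : topologicalType) (K : numFieldType) m n p
    (f : T -> 'M[K]_(m, n)) (g : T -> 'M[K]_(n, p)) :
  continuous f -> continuous g -> continuous (fun x => f x *m g x).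
Proof.
move=> cf cg; apply: mx_continuous => i j.
rewrite (_ : (fun x => _) = fun x => \sum_k f x i k * g x k j); last first.
  by apply/funext => x; rewrite mxE.
move=> x; apply: (@cvg_big _ _ +%R 0) => [|k _]; first exact: add_continuous.
apply: cvgM.
  by apply: (@continuous_comp _ _ _ f (fun A => A i k));
    [exact: cf|exact: coord_continuous].
by apply: (@continuous_comp _ _ _ g (fun A => A k j));
  [exact: cg|exact: coord_continuous].
Qed.

Lemma continuous_row_mx (T : topologicalType) (K : numFieldType) m n p
    (f : T -> 'M[K]_(m, n)) (g : T -> 'M[K]_(m, p)) :
  continuous f -> continuous g -> continuous (fun x => row_mx (f x) (g x)).
Proof.
move=> cf cg; apply: mx_continuous => i j.
case: (split_ordP j) => k ->.
  rewrite (_ : (fun x => _) = fun x => f x i k); last first.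
    by apply/funext => x; rewrite row_mxEl.
  by move=> x; apply: (@continuous_comp _ _ _ f (fun A => A i k));
    [exact: cf|exact: coord_continuous].
rewrite (_ : (fun x => _) = fun x => g x i k); last first.
  by apply/funext => x; rewrite row_mxEr.
by move=> x; apply: (@continuous_comp _ _ _ g (fun A => A i k));
  [exact: cg|exact: coord_continuous].
Qed.

Lemma continuous_dotr (T : topologicalType) (R : realType) n
    (f g : T -> 'rV[R]_n) :
  continuous f -> continuous g -> continuous (fun x => dotr (f x) (g x)).
Proof.
move=> cf cg x; apply: (@cvg_big _ _ +%R 0) => [|k _]; first exact: add_continuous.
apply: cvgM.
  by apply: (@continuous_comp _ _ _ f (fun A => A 0 k));
    [exact: cf|exact: coord_continuous].
by apply: (@continuous_comp _ _ _ g (fun A => A 0 k));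
  [exact: cg|exact: coord_continuous].
Qed.

(** * Lebesgue measure on R^n: sigma-finiteness and iterated integrals *)

Section lebesgueRn.
Context {R : realType}.
Implicit Types n m : nat.

Lemma row_cons_rV n (x : 'rV[R]_n.+1) :
  exists (y : 'rV[R]_n) (t : R), x = row_cons (y, t).
Proof.
exists (@rsubmx _ 1 1 n x), (x 0 0); rewrite -[x in LHS](@hsubmxK _ 1 1 n).
rewrite /row_cons/=; congr (@row_mx _ 1 1 n _ _); apply/matrixP => i j; rewrite !mxE !ord1 eqxx mulr1n.
by congr (x _ _); apply: val_inj.
Qed.

Lemma ball_row_cons n (y : 'rV[R]_n) (t r : R) : 0 < r ->
  ball (0 : 'rV[R]_n.+1) r (row_cons (y, t)) <-> ball 0 r y /\ ball 0 r t.
Proof.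
move=> r0; split=> [[_ yt]|[[_ yr] tr]].
  split.
    split=> // i j; have := yt 0 (rshift 1 j).
    by rewrite /row_cons (@row_mxEr _ 1 1 n) !mxE ord1.
  have := yt 0 (lshift n (0 : 'I_1)).
  by rewrite /row_cons (@row_mxEl _ 1 1 n) !mxE eqxx mulr1n.
split=> // i j; rewrite ord1.
case: (split_ordP (j : 'I_(1 + n))) => [j' ->|j' ->].
  by rewrite /row_cons (@row_mxEl _ 1 1 n) !mxE !ord1 eqxx mulr1n.
by rewrite /row_cons (@row_mxEr _ 1 1 n); have := yr 0 j'; rewrite !mxE.
Qed.

Lemma borel_ball_measurable n (x : 'rV[R]_n) r :
  measurable (ball x r : set (borel 'rV[R]_n)).
Proof. by apply: sub_sigma_algebra; exact: ball_open. Qed.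

Lemma lebesgueRn_ball n (r : R) : 0 < r ->
  (lebesgueRn R n (ball (0%R : 'rV[R]_n) r) < +oo)%E.
Proof.
move=> r0; elim: n => [|n IHn] /=.
  by rewrite diracE; case: (_ \in _); rewrite ?ltry.
rewrite /pushforward.
(* Balls of the sup norm are products, so the measure is computed one coordinate at a time. *)
rewrite (_ : _ @^-1` _ = (ball (0 : 'rV[R]_n) r : set (borel 'rV[R]_n)) `*`
    (ball (0 : R) r : set (measurableTypeR R))); last first.
  apply/seteqP; split=> -[y t] /=; first by move=> /(ball_row_cons _ _ r0).
  by move=> yt; apply/(ball_row_cons _ _ r0).
rewrite product_measure1E; [|exact: borel_ball_measurable|].
  apply: lte_mul_pinfty => //; first by rewrite ge0_fin_numE.
  by have := @lebesgue_measure_ball R 0 r (ltW r0); move=> /= ->; rewrite ltry.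
exact: measurable_ball.
Qed.

Lemma lebesgueRn_sigma_finite n : sigma_finite setT (lebesgueRn R n).
Proof.
exists (fun i : nat => ball (0 : 'rV[R]_n) i.+1%:R : set (borel 'rV[R]_n)).
  apply/seteqP; split=> // x _.
  exists (Num.truncn `|x|) => //; rewrite /= -ball_normE/= sub0r normrN.
  exact: truncnS_gt.
by move=> i; split; [exact: borel_ball_measurable|exact: lebesgueRn_ball].
Qed.

(* [lebesgueRn] itself cannot carry the sigma-finite structure: it is a
   [Measure.type], not a function on sets. *)
Definition lebRn n : set (borel 'rV[R]_n) -> \bar R := lebesgueRn R n.
Arguments lebRn n _ : clear implicits.

HB.instance Definition _ n := Measure.copy (lebRn n) (lebesgueRn R n).

HB.instance Definition _ n := Measure_isSigmaFinite.Build _ _ _ (lebRn n)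
  (@lebesgueRn_sigma_finite n).

(** R^0 has a single point, so every [F] is measurable and the Dirac integral evaluates it there. *)
Lemma integral_lebRn0 (F : 'rV[R]_0 -> \bar R) :
  (\int[lebRn 0]_x F x = F 0%R)%E.
Proof.
rewrite /lebRn/= integral_dirac//.
  by rewrite diracE in_setT mul1e.
move=> _ Y _; rewrite setTI.
have [FY|FY] := pselect (Y (F 0)).
  rewrite (_ : _ @^-1` _ = setT)//; apply/seteqP; split => x //= _.
  by rewrite (_ : x = 0)//; apply/rowP => -[].
rewrite (_ : _ @^-1` _ = set0)//; apply/seteqP; split => x //=.
by rewrite (_ : x = 0)//; apply/rowP => -[].
Qed.

Lemma integral_lebRnS n (F : borel 'rV[R]_n.+1 -> \bar R) :
  measurable_fun [set: borel 'rV[R]_n.+1] F -> (forall x, 0 <= F x)%E ->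
  (\int[lebRn n.+1]_x F x =
   \int[lebRn n]_y \int[lebesgue_measure]_t F (row_cons (y, t)))%E.
Proof.
move=> mF F0.
rewrite (@ge0_integral_pushforward _ _ _ _ _ _ (@measurable_row_cons R n)
  (lebRn n \x @lebesgue_measure R)%E)//.
rewrite preimage_setT.
apply: (@fubini_tonelli1 _ _ _ _ _ (lebRn n) (@lebesgue_measure R)
  (F \o @row_cons R n)); last by move=> z; exact: F0.
by apply: measurableT_comp => //; exact: measurable_row_cons.
Qed.

(** With the scalar coordinate outermost, an induction on the dimension can be applied for each
    fixed [t]. *)
Lemma integral_lebRnS_sym n (F : borel 'rV[R]_n.+1 -> \bar R) :
  measurable_fun [set: borel 'rV[R]_n.+1] F -> (forall x, 0 <= F x)%E ->
  (\int[lebRn n.+1]_x F x =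
   \int[lebesgue_measure]_t \int[lebRn n]_y F (row_cons (y, t)))%E.
Proof.
move=> mF F0; rewrite integral_lebRnS//.
apply: (sfinite_Fubini (lebRn n) (@lebesgue_measure R)
  (fun z => F (row_cons z))) => //.
by apply: measurableT_comp => //; exact: measurable_row_cons.
Qed.

End lebesgueRn.
Arguments lebRn R n _ : clear implicits.

(** * Splitting of coordinates and translation invariance *)

Section lebesgueRn_integral.
Context {R : realType}.
Implicit Types n m k : nat.

Lemma measurable_row_mx k m : measurable_fun [set: borel 'rV[R]_k * borel 'rV[R]_m]
  ((fun z => row_mx z.1 z.2) : _ -> borel 'rV[R]_(k + m)).
Proof.
apply: (@continuous_prod_borel 'rV[R]_k 'rV[R]_m 'rV[R]_(k + m) (fun z => row_mx z.1 z.2)).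
- exact: second_countable_mx.
- exact: second_countable_mx.
- by apply: continuous_row_mx => x; [exact: cvg_fst|exact: cvg_snd].
Qed.

Lemma row_cons_row_mx k m (y : 'rV[R]_k) (z : 'rV[R]_m) (t : R) :
  row_cons (row_mx y z : 'rV_(k + m), t) = row_mx (row_cons (y, t)) z :> 'rV_(k + m).+1.
Proof. by rewrite /row_cons/= (@row_mxA _ 1 1 k m) castmx_id. Qed.

(** Induction on [k]: the scalar coordinate is made the outer variable on both sides, and the
    induction hypothesis treats the rest for fixed [t]. *)
Lemma integral_lebRn_add k m (F : borel 'rV[R]_(k + m) -> \bar R) :
  measurable_fun [set: borel 'rV[R]_(k + m)] F -> (forall x, 0 <= F x)%E ->
  (\int[lebRn R (k + m)%N]_x F x =
   \int[lebRn R k]_y \int[lebRn R m]_z F (row_mx y z))%E.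
Proof.
elim: k F => [|k IH] F mF F0.
  rewrite (integral_lebRn0 (fun y => \int[lebRn R m]_z F (row_mx y z))%E).
  by apply: eq_integral => z _; rewrite row_thin_mx.
rewrite (@integral_lebRnS_sym _ (k + m)) //.
rewrite [RHS]integral_lebRnS_sym; last 2 first.
- apply: (@measurable_fun_fubini_tonelli_F _ _ _ _ _ (lebRn R m)
    (fun z : borel 'rV[R]_k.+1 * borel 'rV[R]_m => F (row_mx z.1 z.2))) => //.
  exact: (measurableT_comp mF (@measurable_row_mx k.+1 m)).
- by move=> x; exact: integral_ge0.
apply: eq_integral => t _; rewrite IH//; last first.
  apply: measurableT_comp => //; apply: measurableT_comp; first exact: measurable_row_cons.
  exact: measurable_fun_pair.
by do 2 (apply: eq_integral => ? _); rewrite row_cons_row_mx.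
Qed.

(** The image of Lebesgue measure under a translation gives intervals their length, so it is
    Lebesgue measure by uniqueness. *)
Lemma integral_lebesgue_shift (a : R) (F : measurableTypeR R -> \bar R) :
  measurable_fun [set: measurableTypeR R] F -> (forall x, 0 <= F x)%E ->
  (\int[lebesgue_measure]_t F (t + a)%R = \int[lebesgue_measure]_t F t)%E.
Proof.
move=> mF F0.
have ma : measurable_fun [set: measurableTypeR R] ((fun t => t + a) : _ -> measurableTypeR R).
  exact: measurable_funD.
pose mu := measure_function_pushforward__canonical__measure_function_Measure
  (@lebesgue_measure R) ma.
transitivity (\int[mu]_t F t)%E.
  by rewrite (@ge0_integral_pushforward _ _ _ _ _ _ ma).
apply: eq_measure_integral => A mA _; apply/esym/lebesgue_measure_unique => //.
move=> _ [[b c] _ <-]; rewrite /mu/= /pushforward.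
rewrite (_ : _ @^-1` _ = `]b - a, c - a]%classic).
  rewrite !lebesgue_measure_itv/= !lte_fin ltrD2r.
  by case: ifP => // _; rewrite -!EFinB; congr EFin; lra.
by apply/seteqP; split => t /=; rewrite !in_itv/= => /andP[h1 h2]; apply/andP; split; lra.
Qed.

Lemma continuous_addl n (a : 'rV[R]_n) : continuous (fun x : 'rV[R]_n => x + a).
Proof.
by move=> x; apply: (@continuousD _ _ _ id (cst a));
  [exact: id|exact: cst_continuous].
Qed.

Lemma integral_lebRn_shift n (a : 'rV[R]_n) (F : borel 'rV[R]_n -> \bar R) :
  measurable_fun [set: borel 'rV[R]_n] F -> (forall x, 0 <= F x)%E ->
  (\int[lebRn R n]_x F (x + a)%R = \int[lebRn R n]_x F x)%E.
Proof.
elim: n a F => [|n IH] a F mF F0.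
  rewrite (integral_lebRn0 (fun x => F (x + a))) integral_lebRn0.
  by congr F; apply/rowP => -[].
have [a' [s ->]] := row_cons_rV a.
have ma : measurable_fun [set: borel 'rV[R]_n.+1]
    ((fun x : 'rV[R]_n.+1 => x + row_cons (a', s)) : _ -> borel 'rV[R]_n.+1).
  apply: (@continuous_borel_borel 'rV[R]_n.+1 'rV[R]_n.+1).
  exact: continuous_addl.
rewrite (integral_lebRnS (F := fun x => F (x + row_cons (a', s))))//; last first.
  exact: (measurableT_comp mF ma).
rewrite [RHS]integral_lebRnS//.
pose H (y : borel 'rV[R]_n) := (\int[lebesgue_measure]_t F (row_cons (y, t)))%E.
have mFr : measurable_fun [set: borel 'rV[R]_n * measurableTypeR R]
   (fun z => F (row_cons z)).
  exact: (measurableT_comp mF (@measurable_row_cons R n)).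
(* The induction hypothesis shifts the first factor inside the partial integral [H]; the scalar
   coordinate is then shifted for fixed [y]. *)
rewrite -(IH a' H); last 2 first.
- exact: (@measurable_fun_fubini_tonelli_F _ _ _ _ _ (@lebesgue_measure R) _ mFr (fun z => F0 _)).
- by move=> y; exact: integral_ge0.
apply: eq_integral => y _; rewrite /H -[RHS](integral_lebesgue_shift s)//; last first.
  exact: (measurableT_comp mFr (pair1_measurable (y + a' : borel _))).
apply: eq_integral => t _; congr F; rewrite /row_cons/=.
by rewrite (@add_row_mx _ 1 1 n) raddfD.
Qed.
End lebesgueRn_integral.

(** * Gaussian integrals and rotation invariance of Lebesgue measure *)

Section gaussian.
Context {R : realType}.
Implicit Types n m k : nat.

Lemma dotr_row_mx k m (y y' : 'rV[R]_k) (z z' : 'rV[R]_m) :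
  dotr (row_mx y z) (row_mx y' z') = dotr y y' + dotr z z'.
Proof. by rewrite !dotrE tr_row_mx mul_row_col mxE. Qed.

Lemma dotr_row_cons n (y : 'rV[R]_n) (t : R) :
  dotr (row_cons (y, t)) (row_cons (y, t)) = t ^+ 2 + dotr y y.
Proof.
rewrite /row_cons/= (@dotr_row_mx 1 n) /dotr big_ord1 !mxE eqxx mulr1n.
by rewrite expr2.
Qed.

Lemma dotr_mulmx n m (x y : 'rV[R]_n) (Q : 'M[R]_(n, m)) :
  Q *m Q^T = 1%:M -> dotr (x *m Q) (y *m Q) = dotr x y.
Proof. by move=> QQ; rewrite !dotrE trmx_mul mulmxA -(mulmxA x) QQ mulmx1. Qed.

Lemma dotrC n (x y : 'rV[R]_n) : dotr x y = dotr y x.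
Proof. by apply: eq_bigr => i _; rewrite mulrC. Qed.

Lemma dotrNN n (x : 'rV[R]_n) : dotr (- x) (- x) = dotr x x.
Proof. by apply: eq_bigr => i _; rewrite !mxE mulrNN. Qed.

Lemma dotrDl n (x y z : 'rV[R]_n) : dotr (x + y) z = dotr x z + dotr y z.
Proof. by rewrite !dotrE mulmxDl mxE. Qed.

Lemma dotrDr n (x y z : 'rV[R]_n) : dotr z (x + y) = dotr z x + dotr z y.
Proof. by rewrite dotrC dotrDl !(dotrC z). Qed.

Lemma dotr_ge0 n (x : 'rV[R]_n) : 0 <= dotr x x.
Proof. by apply: sumr_ge0 => i _; rewrite -expr2 sqr_ge0. Qed.

Lemma sqr_enorm n (x : 'rV[R]_n) : enorm x ^+ 2 = dotr x x.
Proof. by rewrite sqr_sqrtr// dotr_ge0. Qed.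

Definition gaussRn (b : R) n (x : 'rV[R]_n) : R := expR (- b * dotr x x).

Lemma gaussRn_ge0 b n (x : 'rV[R]_n) : 0 <= gaussRn b x.
Proof. exact: expR_ge0. Qed.

Lemma continuous_gaussRn_comp (b : R) n (T : topologicalType) (f : T -> 'rV[R]_n) :
  continuous f -> continuous (fun x => gaussRn b (f x)).
Proof.
move=> cf; have cd := continuous_dotr cf cf.
move=> x; apply: (@continuous_comp _ _ _ (fun x => - b * dotr (f x) (f x)) expR).
  by apply: cvgMr; exact: cd.
exact: continuous_expR.
Qed.

Lemma measurable_gaussRn b n :
  measurable_fun [set: borel 'rV[R]_n] (@gaussRn b n).
Proof. by apply: continuous_borel_measurable; apply: continuous_gaussRn_comp => x; exact: id. Qed.

Lemma gaussRn_mulmx b n (Q : 'M[R]_n) (x : 'rV[R]_n) :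
  Q *m Q^T = 1%:M -> gaussRn b (x *m Q) = gaussRn b x.
Proof. by move=> QQ; rewrite /gaussRn dotr_mulmx. Qed.

(** The integrand is the centred normal density of variance [(2 * b)^-1] divided by its peak value,
    hence [c] is the inverse of that peak. *)
Lemma integral_gaussR (b : R) : 0 < b -> exists2 c : R, 0 < c &
  (\int[lebesgue_measure]_t (expR (- b * t ^+ 2))%:E = c%:E)%E.
Proof.
move=> b0; pose s := Num.sqrt (2 * b)^-1.
have s2 : s ^+ 2 = (2 * b)^-1 by rewrite sqr_sqrtr// invr_ge0; lra.
have s0 : s != 0.
  by apply/eqP => h; move: s2; rewrite h expr0n/= => /esym/eqP; rewrite invr_eq0; lra.
have pk := normal_peak_gt0 s0.
have E (t : R) : normal_pdf 0 s t = normal_peak s * expR (- b * t ^+ 2).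
  rewrite normal_pdfE// /normal_fun subr0 s2; congr (_ * expR _).
  by field; lra.
exists (normal_peak s)^-1; first by rewrite invr_gt0.
have := integral_normal_pdf 0 s.
under eq_integral do rewrite E EFinM.
rewrite ge0_integralZl_EFin ?(ltW pk)//; last first.
  by apply/measurable_EFinP; apply: measurableT_comp => //; exact: measurable_funM.
move=> /(congr1 (fun z => (normal_peak s)^-1%:E * z)%E).
by rewrite muleA -EFinM mulVf ?gt_eqF// mul1e mule1.
Qed.

Lemma integral_gaussRn (b : R) n : 0 < b -> exists2 c : R, 0 < c &
  (\int[lebRn R n]_x (gaussRn b x)%:E = c%:E)%E.
Proof.
move=> b0; elim: n => [|n [c c0 IH]].
  exists 1 => //; rewrite (integral_lebRn0 (fun x => (gaussRn b x)%:E)).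
  by rewrite /gaussRn /dotr big_ord0 mulr0 expR0.
have [d d0 dE] := integral_gaussR b0.
exists (c * d); first exact: mulr_gt0.
rewrite (integral_lebRnS (F := fun x => (gaussRn b x)%:E)); last 2 first.
- by apply/measurable_EFinP; exact: measurable_gaussRn.
- by move=> x; rewrite lee_fin gaussRn_ge0.
rewrite EFinM -IH -ge0_integralZr//; last 3 first.
- by apply/measurable_EFinP; exact: measurable_gaussRn.
- by move=> x _; rewrite lee_fin gaussRn_ge0.
- by rewrite lee_fin ltW.
apply: eq_integral => y _; rewrite -dE -ge0_integralZl//; last 2 first.
- by apply/measurable_EFinP; apply: measurableT_comp => //; exact: measurable_funM.
- by rewrite lee_fin gaussRn_ge0.
apply: eq_integral => t _.
by rewrite /gaussRn dotr_row_cons -EFinM -expRD; congr ((expR _)%:E); lra.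
Qed.

(** Rotation invariance follows from translation invariance and Tonelli. Both sides are multiplied
    by the integral [c] of a Gaussian [G], which is even, rotation invariant and of positive finite
    integral; translations then move [Q] from [F] to [G], where it disappears. *)
Lemma integral_lebRn_mulmx n (Q : 'M[R]_n) (F : borel 'rV[R]_n -> \bar R) :
  Q *m Q^T = 1%:M -> measurable_fun [set: borel 'rV[R]_n] F ->
  (forall x, 0 <= F x)%E ->
  (\int[lebRn R n]_x F (x *m Q)%R = \int[lebRn R n]_x F x)%E.
Proof.
move=> QQ mF F0.
have QtQ : Q^T *m Q = 1%:M by exact: mulmx1C.
pose G (x : 'rV[R]_n) : \bar R := (gaussRn 1 x)%:E.
have G0 x : (0 <= G x)%E by rewrite lee_fin gaussRn_ge0.
have [c c0 cE] : exists2 c : R, 0 < c & (\int[lebRn R n]_x G x = c%:E)%E.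
  exact: integral_gaussRn.
have cQ : continuous (fun x : 'rV[R]_n => x *m Q).
  by apply: continuous_mulmx; [move=> x; exact: id|exact: cst_continuous].
pose X : Type := ('rV[R]_n * 'rV[R]_n)%type.
have cX1 : continuous (fun z : X => z.1 *m Q).
  by apply: continuous_mulmx; [move=> z; exact: cvg_fst|exact: cst_continuous].
have cX2 : continuous (fun z : X => z.2) by move=> z; exact: cvg_snd.
have scX := @second_countable_mx R 1 n.
have mX (h : X -> 'rV[R]_n) : continuous h -> measurable_fun
    [set: borel 'rV[R]_n * borel 'rV[R]_n] (h : _ -> borel 'rV[R]_n).
  exact: continuous_prod_borel.
have mG (h : X -> 'rV[R]_n) : continuous h -> measurable_fun
    [set: borel 'rV[R]_n * borel 'rV[R]_n] (fun z => G (h z)).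
  move=> ch; apply/measurable_EFinP.
  apply: (@continuous_prod_measurable R 'rV[R]_n 'rV[R]_n
    (fun z => gaussRn 1 (h z))) => //.
  exact: continuous_gaussRn_comp.
have mGB : measurable_fun [set: borel 'rV[R]_n * borel 'rV[R]_n]
    (fun z => G (z.2 - z.1 *m Q)).
  by apply: mG => z; apply: cvgB; [exact: cX2|exact: cX1].
have swap (f : borel 'rV[R]_n * borel 'rV[R]_n -> \bar R) :
    measurable_fun setT f -> (forall z, 0 <= f z)%E ->
    (\int[lebRn R n]_x \int[lebRn R n]_y f (x, y) =
     \int[lebRn R n]_y \int[lebRn R n]_x f (x, y))%E.
  by move=> mf f0; exact: sfinite_Fubini.
have mFQ : measurable_fun [set: borel 'rV[R]_n] (fun x => F (x *m Q)).
  exact: (measurableT_comp mF (continuous_borel_borel cQ)).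
have cne0 : (c%:E != 0)%E by rewrite gt_eqF ?lte_fin.
suff : (c%:E * \int[lebRn R n]_x F (x *m Q)%R = c%:E * \int[lebRn R n]_x F x)%E.
  move=> /(congr1 (fun z => c^-1%:E * z)%E).
  by rewrite !muleA -EFinM mulVf ?gt_eqF// !mul1e.
rewrite -ge0_integralZl//; last by rewrite lee_fin ltW.
rewrite -[RHS]ge0_integralZl//; last by rewrite lee_fin ltW.
have mGy (a : 'rV[R]_n) : measurable_fun [set: borel 'rV[R]_n] (fun y => G (y + a)).
  apply/measurable_EFinP.
  apply: (@continuous_borel_measurable R 'rV[R]_n (fun y => gaussRn 1 (y + a))).
  by apply: continuous_gaussRn_comp; exact: continuous_addl.
transitivity (\int[lebRn R n]_x \int[lebRn R n]_y (G y * F (x *m Q)%R))%E.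
  apply: eq_integral => x _; rewrite -cE ge0_integralZr//.
  by have := mGy 0; under eq_fun do rewrite addr0.
rewrite (swap (fun z => G z.2 * F (z.1 *m Q)%R)%E); last 2 first.
- apply: emeasurable_funM; first exact: mG.
  exact: (measurableT_comp mF (mX _ cX1)).
- by move=> z; rewrite mule_ge0.
(* For fixed [y], the shift of [x] by [y *m Q^T] adds [y] to [x *m Q]. *)
transitivity (\int[lebRn R n]_y \int[lebRn R n]_x (G y * F (x *m Q + y)%R))%E.
  apply: eq_integral => y _.
  rewrite -(integral_lebRn_shift (y *m Q^T)
    (F := fun x => (G y * F (x *m Q)%R)%E)); last 2 first.
  - by apply: measurable_funeM.
  - by move=> x; rewrite mule_ge0.
  by apply: eq_integral => x _; rewrite mulmxDl -mulmxA QtQ mulmx1.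
rewrite -(swap (fun z => G z.2 * F (z.1 *m Q + z.2)%R)%E); last 2 first.
- apply: emeasurable_funM; first exact: mG.
  apply: (measurableT_comp mF (mX (fun z => z.1 *m Q + z.2) _)) => z.
  by apply: cvgD; [exact: cX1|exact: cX2].
- by move=> z; rewrite mule_ge0.
(* For fixed [x], substituting [y - x *m Q] for [y] leaves [F] free of [Q]. *)
transitivity (\int[lebRn R n]_x \int[lebRn R n]_y (G (y - x *m Q)%R * F y))%E.
  apply: eq_integral => x _.
  rewrite -[RHS](integral_lebRn_shift (x *m Q)
    (F := fun y => (G (y - x *m Q)%R * F y)%E)); last 2 first.
  - by apply: emeasurable_funM => //; exact: mGy.
  - by move=> y; rewrite mule_ge0.
  by apply: eq_integral => y _; rewrite addrK addrC.
rewrite (swap (fun z => G (z.2 - z.1 *m Q)%R * F z.2)%E); last 2 first.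
- apply: emeasurable_funM => //.
  exact: (measurableT_comp mF (mX _ cX2)).
- by move=> z; rewrite mule_ge0.
apply: eq_integral => y _ /=; rewrite ge0_integralZr//; last first.
  exact: (measurableT_comp mGB (pair2_measurable (y : borel _))).
(* Since [G] is even and rotation invariant, [G (y - x *m Q)] equals [G (x - y *m Q^T)], whose
   integral in [x] is [c] by translation. *)
congr (_ * _)%E; rewrite -cE -[RHS](integral_lebRn_shift (- (y *m Q^T))); last 2 first.
- by have := mGy 0; under eq_fun do rewrite addr0.
- by move=> ?; exact: G0.
apply: eq_integral => x _; rewrite /G -[in RHS](gaussRn_mulmx 1 (x - _) QQ).
by rewrite mulmxBl -mulmxA QtQ mulmx1 /gaussRn -dotrNN opprB.
Qed.
End gaussian.

(** * Orthonormal frames and orthogonal decompositions of R^n *)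

Section frames.
Context {R : realType}.
Implicit Types n m k : nat.

(** Gram-Schmidt, one row at a time: [B] is a frame for the rows below the first row [v], and [u] is
    the part of [v] orthogonal to [B]. If [u] vanishes, [B] already suffices; otherwise [u] is
    normalised and added. *)
Lemma orthonormal_frame_ex m n (A : 'M[R]_(m, n)) :
  exists r (B : 'M[R]_(r, n)), B *m B^T = 1%:M /\ (B :=: A)%MS.
Proof.
elim: m A => [|m IH] A.
  exists 0, A; split; last exact: eqmx_refl.
  by apply/matrixP => -[].
have [r [B [BB BA]]] := IH (@dsubmx _ 1 m n A).
pose v := @usubmx _ 1 m n A.
have AE : (A :=: v + B)%MS.
  rewrite -{1}(@vsubmxK _ 1 m n A).
  apply: (eqmx_trans (eqmx_sym (addsmxE v (@dsubmx _ 1 m n A)))).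
  by apply: adds_eqmx; [exact: eqmx_refl|exact: eqmx_sym].
pose u := v - v *m B^T *m B.
have uB : u *m B^T = 0 by rewrite mulmxBl -(mulmxA _ B) BB mulmx1 subrr.
have [u0|u0] := eqVneq u 0.
  exists r, B; split => //; apply: eqmx_trans (eqmx_sym AE).
  apply/eqmxP; rewrite addsmxSr/= addsmx_sub submx_refl andbT.
  by rewrite -[v](subrK (v *m B^T *m B)) -/u u0 add0r submxMl.
have uu : dotr u u != 0 by apply: contra_neq u0; exact: dotr_eq0.
pose s := (Num.sqrt (dotr u u))^-1.
have s2 : s * (s * dotr u u) = 1.
  rewrite mulrA -expr2 /s exprVn sqr_sqrtr ?dotr_ge0// mulVf//.
have s0 : s != 0 by rewrite invr_eq0 sqrtr_eq0 -ltNge lt_def uu dotr_ge0.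
exists (1 + r)%N, (col_mx (s *: u) B); split.
  rewrite tr_col_mx mul_col_row BB -!scalemxAl uB scaler0.
  have -> : B *m (s *: u)^T = 0.
    by rewrite -[B]trmxK -trmx_mul -scalemxAl uB scaler0 trmx0.
  have -> : u *m (s *: u)^T = (s * dotr u u)%:M.
    rewrite linearZ/= -scalemxAr [u *m _]mx11_scalar -dotrE.
    by rewrite scale_scalar_mx.
  by rewrite scale_scalar_mx s2 -scalar_mx_block.
apply: eqmx_trans (eqmx_sym AE).
apply: (eqmx_trans (eqmx_sym (addsmxE (s *: u) B))).
apply/eqmxP; rewrite !addsmx_sub !addsmxSr !andbT; apply/andP; split.
  apply: scalemx_sub; rewrite addmx_sub ?addsmxSl// eqmx_opp.
  exact: submx_trans (submxMl _ _) (addsmxSr _ _).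
rewrite -[X in (X <= _)%MS](subrK (v *m B^T *m B)) -/u addmx_sub//.
  rewrite -[X in (X <= _)%MS]scale1r -(mulVf s0) -scalerA.
  by apply: scalemx_sub; exact: addsmxSl.
exact: submx_trans (submxMl _ _) (addsmxSr _ _).
Qed.

Lemma orthonormal_rank m n (B : 'M[R]_(m, n)) :
  B *m B^T = 1%:M -> \rank B = m.
Proof.
move=> BB; apply/eqP; rewrite eqn_leq rank_leq_row/=.
by rewrite -{1}(mxrank1 R m) -BB mxrankM_maxl.
Qed.

Lemma vspace_frame_ex n (H : {vspace 'rV[R]_n}) :
  exists C : 'M[R]_(\dim H, n), C *m C^T = 1%:M /\
    forall z : 'rV_n, (z <= C)%MS <-> z \in H.
Proof.
pose V : 'M[R]_(\dim H, n) := \matrix_i (vbasis H)`_i.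
have mulV (c : 'rV_(\dim H)) : c *m V = \sum_i c 0 i *: (vbasis H)`_i.
  by rewrite mulmx_sum_row; apply: eq_bigr => i _; rewrite rowK.
have VH (z : 'rV_n) : (z <= V)%MS <-> z \in H.
  split=> [/submxP[c ->]|zH].
    rewrite mulV; apply: memv_suml => i _; apply: memvZ; apply: vbasis_mem.
    by rewrite mem_nth// size_tuple.
  apply/submxP; exists (\row_i coord (vbasis H) i z).
  by rewrite mulV {1}(coord_vbasis zH); apply: eq_bigr => i _; rewrite mxE.
have rV : \rank V = \dim H.
  apply/eqP; rewrite -/(row_free V) -kermx_eq0; apply/eqP/row_matrixP => i.
  rewrite row0; apply/rowP => j; rewrite [RHS]mxE.
  have /freeP := basis_free (vbasisP H); apply.
  by rewrite -mulV -row_mul mulmx_ker row0.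
have [r [C [CC CV]]] := orthonormal_frame_ex V.
have rE : r = \dim H by rewrite -(orthonormal_rank CC) CV.
subst r; exists C; split=> // z; rewrite CV; exact: VH.
Qed.

(** The orthogonal complement is the kernel of [C^T], whose rank is [n - m]; Gram-Schmidt supplies
    the frame. *)
Lemma perp_frame_ex n (H : {vspace 'rV[R]_n}) m (C : 'M[R]_(m, n)) :
  C *m C^T = 1%:M -> (forall z : 'rV_n, (z <= C)%MS <-> z \in H) ->
  exists B : 'M[R]_(n - m, n), B *m B^T = 1%:M /\
    forall z, (z <= B)%MS <-> perp H z.
Proof.
move=> CC CH.
have [r [B [BB BK]]] := orthonormal_frame_ex (kermx C^T).
have rE : r = (n - m)%N.
  by rewrite -(orthonormal_rank BB) BK mxrank_ker mxrank_tr orthonormal_rank.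
subst r; exists B; split=> // z; rewrite BK; split=> [/sub_kermxP zC u /CH/submxP[c ->]|zp].
  by rewrite dotrE trmx_mul mulmxA zC mul0mx mxE.
apply/sub_kermxP/rowP => i; rewrite [RHS]mxE.
have := zp (row i C); rewrite dotrE => <-; last by apply/CH; exact: row_sub.
by rewrite !mxE; apply: eq_bigr => j _; rewrite !mxE.
Qed.

(** The decomposition is unique: the difference of two candidates lies both in [H] and in its
    complement, so it is orthogonal to itself. *)
Lemma perp_projE n (H : {vspace 'rV[R]_n}) (y z : 'rV[R]_n) :
  perp H y -> z \in H -> perp_proj H (y + z) = y.
Proof.
move=> yH zH.
have [pH qH] := xgetPex 0 (perp_decomposition H (y + z)).
rewrite -/(perp_proj H (y + z)) in pH qH *.
set q := perp_proj H (y + z) in pH qH *.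
have yq : y - q \in H.
  by rewrite (_ : y - q = y + z - q - z); [exact: rpredB|rewrite addrAC addrK].
apply/esym/eqP; rewrite -subr_eq0; apply/eqP/dotr_eq0.
have dN (u v w : 'rV[R]_n) : dotr (u - v) w = dotr u w - dotr v w.
  by rewrite !dotrE mulmxBl !mxE.
by rewrite dN yH// pH// subrr.
Qed.

(** The two frames stacked together form an orthogonal matrix [Q]; rotation invariance reduces the
    claim to a splitting of coordinates. *)
Lemma integral_orthonormal_split n k m (e : n = (k + m)%N)
    (B : 'M[R]_(k, n)) (C : 'M[R]_(m, n)) (F : borel 'rV[R]_n -> \bar R) :
  B *m B^T = 1%:M -> C *m C^T = 1%:M -> B *m C^T = 0 ->
  measurable_fun [set: borel 'rV[R]_n] F -> (forall x, 0 <= F x)%E ->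
  (\int[lebRn R n]_x F x =
   \int[lebRn R k]_y \int[lebRn R m]_z F (y *m B + z *m C)%R)%E.
Proof.
subst n => BB CC BC mF F0.
have CB : C *m B^T = 0 by rewrite -[C]trmxK -trmx_mul BC trmx0.
pose Q : 'M[R]_(k + m) := col_mx B C.
have QQ : Q *m Q^T = 1%:M.
  by rewrite tr_col_mx mul_col_row BB CC BC CB -scalar_mx_block.
rewrite -[LHS](integral_lebRn_mulmx QQ mF F0) [LHS]integral_lebRn_add; first last.
- by move=> x; exact: F0.
- apply: (measurableT_comp mF).
  apply: (@continuous_borel_borel 'rV[R]_(k + m) 'rV[R]_(k + m)).
  by apply: continuous_mulmx; [move=> x; exact: id|exact: cst_continuous].
by do 2 (apply: eq_integral => ? _); rewrite mul_row_col.
Qed.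

End frames.

(** * Continuity on the Grassmannian and integration over orthogonal complements *)

Lemma pair_continuous (S T U : topologicalType) (f : S -> T) (g : S -> U) :
  continuous f -> continuous g -> continuous (fun x => (f x, g x)).
Proof. by move=> cf cg x; apply: cvg_pair; [exact: cf|exact: cg]. Qed.

Lemma fst_continuous (S T : topologicalType) : continuous (@fst S T).
Proof. by move=> x; exact: cvg_fst. Qed.

Section grassmannian.
Context {R : realType} {n k : nat}.
Implicit Types (H : grass R n k) (x : 'rV[R]_n).

(** The projection is defined by choice; its linearity comes from the formula [1 - C^T *m C], for
    [C] an orthonormal frame of [V]. *)
Lemma perp_proj_mulmx (V : {vspace 'rV[R]_n}) x :
  perp_proj V x = x *m lin1_mx (perp_proj V).
Proof.
have [C [CC CV]] := vspace_frame_ex V.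
have projE y : perp_proj V y = y *m (1%:M - C^T *m C).
  have {1}-> : y = y *m (1%:M - C^T *m C) + y *m C^T *m C.
    by rewrite mulmxBr mulmx1 mulmxA subrK.
  apply: perp_projE => [u /CV/submxP[c ->]|]; last by apply/CV; exact: submxMl.
  rewrite dotrE trmx_mul mulmxA -(mulmxA y) mulmxBl mul1mx -(mulmxA _ C) CC mulmx1.
  by rewrite subrr mulmx0 mul0mx mxE.
rewrite [LHS]projE; congr (_ *m _); apply/matrixP => i j.
by rewrite !mxE projE -rowE !mxE.
Qed.

Lemma continuous_perp_proj (V : {vspace 'rV[R]_n}) : continuous (perp_proj V).
Proof.
rewrite (_ : perp_proj V = fun x => x *m lin1_mx (perp_proj V)); last first.
  by apply/funext => x; exact: perp_proj_mulmx.
by apply: continuous_mulmx; [move=> x; exact: id|exact: cst_continuous].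
Qed.

(** The topology of the Grassmannian makes the projection matrix continuous in [H], so its product
    with [x] is jointly continuous. *)
Lemma continuous_perp_proj_grass :
  continuous (fun a : grass R n k * 'rV[R]_n => perp_proj (grass_vspace a.1) a.2).
Proof.
rewrite (_ : (fun a => _) = fun a => (a : grass R n k * _).2 *m Defs.proj_mx a.1); last first.
  by apply/funext => a; exact: perp_proj_mulmx.
apply: continuous_mulmx; first by move=> x; exact: cvg_snd.
have pc : continuous (@Defs.proj_mx R n k : grass R n k -> 'M[R]_n).
  exact: initial_continuous.
move=> x; apply: (@continuous_comp (grass R n k * 'rV[R]_n)%type (grass R n k) _ fst).
  exact: cvg_fst.
exact: pc.
Qed.

Lemma continuous_aff : continuous (fun a : grass R n k * 'rV[R]_n => aff a.1 a.2).
Proof.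
apply/continuousP => _ [B oB <-]; rewrite -comp_preimage.
move: B oB; apply/continuousP.
exact: (pair_continuous (@fst_continuous (grass R n k) 'rV[R]_n)
  continuous_perp_proj_grass).
Qed.

Lemma grass_frames H : (k <= n)%N ->
  [/\ perp_frame H *m (perp_frame H)^T = 1%:M,
      forall y, perp (grass_vspace H) (y *m perp_frame H) &
      exists C : 'M[R]_(n - k, n), [/\ C *m C^T = 1%:M,
        perp_frame H *m C^T = 0 & forall z, z *m C \in grass_vspace H]].
Proof.
move=> kn; have dH : \dim (grass_vspace H) = (n - k)%N by exact/eqP/(valP H).
have := vspace_frame_ex (grass_vspace H); rewrite dH => -[C [CC CH]].
have := perp_frame_ex CC CH; rewrite subKn// => -[B Bspec].
have [BB BH] : perp_frame H *m (perp_frame H)^T = 1%:M /\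
    forall z, (z <= perp_frame H)%MS <-> perp (grass_vspace H) z.
  (* The existence of [B] excludes the default value of the choice, so [perp_frame H] is a genuine
     frame. *)
  by rewrite /perp_frame; case: xgetP => [M _ //|/(_ B)].
split => // [y|]; first by apply/BH; exact: submxMl.
exists C; split=> // [|z]; last by apply/CH; exact: submxMl.
apply/matrixP => i j; rewrite [RHS]mxE.
have := (BH (row i (perp_frame H))).1 (row_sub _ _) (row j C).
rewrite dotrE => <-; last by apply/CH; exact: row_sub.
by rewrite !mxE; apply: eq_bigr => l _; rewrite !mxE.
Qed.

Lemma perp_projK (V : {vspace 'rV[R]_n}) x : perp_proj V (perp_proj V x) = perp_proj V x.
Proof. by rewrite -[in LHS](addr0 (perp_proj V x)) perp_projE ?mem0v//; exact: perp_perp_proj. Qed.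

Lemma measurable_perp_weight (b : R) H (F : borel 'rV[R]_n -> \bar R) :
  measurable_fun [set: borel 'rV[R]_n] F ->
  measurable_fun [set: borel 'rV[R]_n] (fun x => F (perp_proj (grass_vspace H) x) *
     (gaussRn b (x - perp_proj (grass_vspace H) x))%:E)%E.
Proof.
move=> mF; have cP := @continuous_perp_proj (grass_vspace H).
apply: emeasurable_funM.
  exact: (measurableT_comp mF (continuous_borel_borel cP)).
apply/measurable_EFinP; apply: (@continuous_borel_measurable R 'rV[R]_n
  (fun x => gaussRn b (x - perp_proj (grass_vspace H) x))).
apply: continuous_gaussRn_comp => x.
by apply: (@continuousB _ _ _ id (perp_proj (grass_vspace H))); [exact: id|exact: cP].
Qed.

Lemma integral_perp_lebRn H (F : 'rV[R]_n -> \bar R) :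
  integral_perp H F = (\int[lebRn R k]_y F (y *m perp_frame H))%E.
Proof. by []. Qed.

(** In the coordinates [x = y *m B + z *m C] adapted to the complement of [H] and to [H], the
    projection of [x] is [y *m B], and the weight is a Gaussian in [z] alone. The inner integral is
    thus the constant [c]. *)
Lemma integral_perpE (b c : R) H (F : borel 'rV[R]_n -> \bar R) :
  (k <= n)%N -> 0 <= c ->
  (\int[lebRn R (n - k)]_z (gaussRn b z)%:E = c%:E)%E ->
  measurable_fun [set: borel 'rV[R]_n] F -> (forall x, 0 <= F x)%E ->
  (\int[lebRn R n]_x (F (perp_proj (grass_vspace H) x) *
     (gaussRn b (x - perp_proj (grass_vspace H) x))%:E) =
   integral_perp H F * c%:E)%E.
Proof.
move=> kn c0 cE mF F0.
have [BB BH [C [CC BC CH]]] := grass_frames H kn.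
rewrite (integral_orthonormal_split (esym (subnKC kn)) BB CC BC); last 2 first.
- exact: measurable_perp_weight.
- by move=> x; rewrite mule_ge0// lee_fin gaussRn_ge0.
rewrite integral_perp_lebRn -[RHS]ge0_integralZr//; last first.
  apply: (measurableT_comp mF).
  apply: (@continuous_borel_borel 'rV[R]_k 'rV[R]_n (fun y => y *m perp_frame H)).
  by apply: continuous_mulmx; [move=> x; exact: id|exact: cst_continuous].
apply: eq_integral => y _; rewrite -cE -[RHS]ge0_integralZl; first last.
- exact: F0.
- by move=> z _; rewrite lee_fin gaussRn_ge0.
- by apply/measurable_EFinP; exact: measurable_gaussRn.
- by [].
apply: eq_integral => z _; rewrite perp_projE//.
by rewrite addrC addKr /gaussRn dotr_mulmx.
Qed.

End grassmannian.

(** * The Hoelder argument on an abstract measure space *)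

(** Here [e] stands for the Gaussian [e^(-b |z|^2)], so its power [(p - 1)^-1] is the profile
    [e^(-alpha |z|^2)] that controls [G]. The three steps bound [X] by a multiple of
    [X^((p-1)/p) N^(1/p)], and finiteness of [X] permits the division. *)
Lemma hoelder_self_bound d (T : measurableType d) (R : realType)
    (m : {measure set T -> \bar R}) (G u e : T -> R) (p M beta gamma : R) :
  measurable_fun [set: T] G -> measurable_fun [set: T] u ->
  measurable_fun [set: T] e ->
  1 < p -> 0 <= M -> 0 < beta -> 0 < gamma ->
  (forall t, 0 < G t) -> (forall t, 0 <= u t) -> (forall t, 0 <= e t) ->
  (forall t, beta * e t `^ (p - 1)^-1 <= G t) ->
  (forall t, G t <= gamma * e t `^ (p - 1)^-1) ->
  (\int[m]_t (G t * u t * e t)%:E <= M%:E * \int[m]_t (u t * e t)%:E)%E ->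
  (\int[m]_t (G t `^ p * u t)%:E < +oo)%E ->
  (\int[m]_t (u t)%:E < +oo)%E ->
  ((\int[m]_t (G t `^ p * u t)%:E) `^ p^-1 <=
    ((gamma / beta) `^ (p - 1) * M)%:E * (\int[m]_t (u t)%:E) `^ p^-1)%E.
Proof.
move=> mG mu me p1 M0 b0 c0 G0 u0 e0 Gl Gu main Xoo Noo.
have p0 : 0 < p by lra.
have q0 : 0 < p - 1 by lra.
have pn0 : p != 0 by rewrite gt_eqF.
have qn0 : p - 1 != 0 by rewrite gt_eqF.
have eE t : (e t `^ (p - 1)^-1) `^ (p - 1) = e t.
  by rewrite -powRrM mulVf// powRr1.
have Gl' t : beta `^ (p - 1) * e t <= G t `^ (p - 1).
  rewrite -[X in _ * X]eE -powRM ?powR_ge0 ?(ltW b0)//.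
  by apply: ge0_ler_powR => //; rewrite ?nnegrE ?mulr_ge0 ?powR_ge0 ?ltW.
have Gu' t : G t `^ (p - 1) <= gamma `^ (p - 1) * e t.
  rewrite -[X in _ * X]eE -powRM ?powR_ge0 ?(ltW c0)//.
  by apply: ge0_ler_powR => //; rewrite ?nnegrE ?mulr_ge0 ?powR_ge0 ?ltW.
have GpE t : G t `^ p = G t * G t `^ (p - 1).
  by rewrite -[X in X * _]powRr1 ?ltW// -powRD ?(gt_eqF (G0 t)) ?implybT//; congr (_ `^ _); lra.
have mGp r : measurable_fun [set: T] (fun t => G t `^ r).
  exact: (measurableT_comp (measurable_powR r) mG).
set X := (\int[m]_t (G t `^ p * u t)%:E)%E in Xoo *.
set N := (\int[m]_t (u t)%:E)%E in Noo *.
have X0 : (0 <= X)%E by apply: integral_ge0 => t _; rewrite lee_fin mulr_ge0 ?powR_ge0.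
have N0 : (0 <= N)%E by apply: integral_ge0 => t _; rewrite lee_fin.
(* One factor [G] is kept for the hypothesis [main]; the other [p - 1] are absorbed by the upper
   bound. *)
have step1 : (X <= (gamma `^ (p - 1))%:E * \int[m]_t (G t * u t * e t)%:E)%E.
  rewrite -ge0_integralZl_EFin ?powR_ge0//; last 2 first.
  - by move=> t _; rewrite lee_fin !mulr_ge0// ltW.
  - by apply/measurable_EFinP; do 2 apply: measurable_funM => //.
  apply: ge0_le_integral => //.
  - by move=> t _; rewrite lee_fin mulr_ge0 ?powR_ge0.
  - by apply/measurable_EFinP; apply: measurable_funM.
  - by apply/measurable_EFinP; do 3 apply: measurable_funM => //.
  - move=> t _; rewrite -EFinM lee_fin GpE.
    have := Gu' t; have := G0 t; have := u0 t.
    move: (G t `^ (p - 1)) (gamma `^ (p - 1)) => x y h1 h2 h3.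
    rewrite (_ : _ * x * _ = G t * u t * x); last by ring.
    rewrite (_ : y * _ = G t * u t * (y * e t)); last by ring.
    by apply: ler_wpM2l => //; rewrite mulr_ge0// ltW.
(* The lower bound turns [e] back into [G^(p-1)]. *)
have step2 : (\int[m]_t (u t * e t)%:E <=
    (beta `^ (p - 1))^-1%:E * \int[m]_t (u t * G t `^ (p - 1))%:E)%E.
  have bp : 0 < beta `^ (p - 1) by rewrite powR_gt0.
  rewrite -ge0_integralZl_EFin ?invr_ge0 ?powR_ge0//; last 2 first.
  - by move=> t _; rewrite lee_fin mulr_ge0 ?powR_ge0.
  - by apply/measurable_EFinP; apply: measurable_funM.
  apply: ge0_le_integral => //.
  - by move=> t _; rewrite lee_fin mulr_ge0.
  - by apply/measurable_EFinP; apply: measurable_funM.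
  - by apply/measurable_EFinP; do 2 apply: measurable_funM => //.
  - move=> t _; rewrite -EFinM lee_fin mulrCA ler_wpM2l//.
    by rewrite ler_pdivlMl.
(* Hoelder with conjugate exponents [q = p / (p - 1)] and [p], after distributing [u] as
   [u^(1/q) u^(1/p)]. *)
have step3 : (\int[m]_t (u t * G t `^ (p - 1))%:E <=
    X `^ ((p - 1) / p) * N `^ p^-1)%E.
  pose q := p / (p - 1).
  have qq0 : 0 < q by rewrite divr_gt0.
  pose f1 t := G t `^ (p - 1) * u t `^ q^-1.
  pose f2 t := u t `^ p^-1.
  have mf1 : measurable_fun [set: T] f1.
    by apply: measurable_funM => //; exact: (measurableT_comp (measurable_powR _) mu).
  have mf2 : measurable_fun [set: T] f2.
    exact: (measurableT_comp (measurable_powR _) mu).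
  have pq : q^-1 + p^-1 = 1 by rewrite /q; field; lra.
  have := hoelder m mf1 mf2 qq0 p0 pq.
  rewrite Lnorm1 unlock /=.
  under eq_integral.
    move=> t _; rewrite /f1 /f2 ger0_norm ?mulr_ge0 ?powR_ge0//.
    rewrite -mulrA -powRD ?pq ?powRr1// ?oner_eq0 ?implybT//; over.
  under eq_integral do rewrite /= mulrC.
  have -> : (\int[m]_t (`|f1 t| `^ q)%:E = X)%E.
    apply: eq_integral => t _; congr EFin.
    rewrite ger0_norm ?mulr_ge0 ?powR_ge0// powRM ?powR_ge0// -!powRrM mulVf ?gt_eqF//.
    by rewrite powRr1//; congr (_ `^ _ * _); rewrite /q; field; lra.
  have -> : (\int[m]_t (`|f2 t| `^ p)%:E = N)%E.
    apply: eq_integral => t _; congr EFin.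
    by rewrite ger0_norm ?powR_ge0// -!powRrM mulVf ?powRr1.
  by rewrite /q invf_div.
have : (X <= (gamma `^ (p - 1))%:E * (M%:E * ((beta `^ (p - 1))^-1%:E *
    (X `^ ((p - 1) / p) * N `^ p^-1))))%E.
  apply: (le_trans step1); apply: lee_wpmul2l; first by rewrite lee_fin powR_ge0.
  apply: (le_trans main); apply: lee_wpmul2l; first by rewrite lee_fin.
  apply: (le_trans step2); apply: lee_wpmul2l => //.
  by rewrite lee_fin invr_ge0 powR_ge0.
have Xf : X \is a fin_num by rewrite ge0_fin_numE.
have Nf : N \is a fin_num by rewrite ge0_fin_numE.
move: X0 N0; rewrite -(fineK Xf) -(fineK Nf); move: (fine X) (fine N) => x y.
rewrite !lee_fin => x0 y0 H.
(* The case [x = 0] is settled apart, since the other one divides by a power of [x]. *)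
have [->|xn0] := eqVneq x 0.
  by rewrite powR0 ?invr_eq0// !mulr_ge0 ?powR_ge0.
have xp : 0 < x by rewrite lt_def xn0.
have xa : 0 < x `^ ((p - 1) / p) by rewrite powR_gt0.
rewrite -(ler_pM2r xa) -powRD ?xn0 ?implybT//.
rewrite (_ : p^-1 + (p - 1) / p = 1); last by field; lra.
rewrite powRr1//; apply: (le_trans H).
rewrite powRM ?invr_ge0 ?(ltW b0) ?(ltW c0)// -(powR_inv1 (ltW b0)) -powRrM mulN1r powRN.
by rewrite le_eqVlt; apply/orP; left; apply/eqP; ring.
Qed.

(** * Finite measures on the Grassmannian and the dual Radon transform *)

(** This copy of [mu] carries the finite-measure structure obtained from the proof [h], as Tonelli
    for the product with Lebesgue measure requires. *)
Definition finmeas d (T : measurableType d) (R : realType)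
  (mu : {measure set T -> \bar R}) (h : fin_num_fun mu) : set T -> \bar R := mu.

HB.instance Definition _ d (T : measurableType d) (R : realType)
  (mu : {measure set T -> \bar R}) (h : fin_num_fun mu) :=
  Measure.copy (finmeas h) mu.

HB.instance Definition _ d (T : measurableType d) (R : realType)
  (mu : {measure set T -> \bar R}) (h : fin_num_fun mu) :=
  Measure_isFinite.Build _ _ _ (finmeas h) h.

Section dual_radon.
Context {R : realType} {n k : nat}.
Implicit Types (H : grass R n k) (x : 'rV[R]_n).

Lemma second_countable_grass : @second_countable (grass R n k).
Proof.
exact: (@second_countable_initial (codim_subspace R n k) _ (@Defs.proj_mx R n k)
  (@second_countable_mx R n n)).
Qed.

Lemma measurable_aff (psi : affgrass R n k -> R) : continuous psi ->
  measurable_fun [set: borel (grass R n k) * borel 'rV[R]_n]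
    (fun a => psi (aff a.1 a.2)).
Proof.
move=> cpsi.
apply: (@continuous_prod_measurable R (grass R n k) 'rV[R]_n
  (fun a => psi (aff a.1 a.2))).
- exact: second_countable_grass.
- exact: second_countable_mx.
move=> a; apply: (@continuous_comp (grass R n k * 'rV[R]_n)%type _ _
  (fun a => aff a.1 a.2) psi).
  exact: continuous_aff.
exact: cpsi.
Qed.

Lemma aff_perp_proj H x : aff H (perp_proj (grass_vspace H) x) = aff H x.
Proof. by apply: val_inj => /=; rewrite perp_projK. Qed.

(** Off a compact set the function is below 1 in absolute value; on it, continuity gives a bound. *)
Lemma C0_bounded (g : affgrass R n k -> R) : C0 g ->
  exists M : R, forall a, `|g a| <= M.
Proof.
move=> [cg /(_ 1 ltr01)[K cK gK]].
have : compact (g @` K).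
  by apply: continuous_compact => //; exact: continuous_subspaceT.
move=> /compact_bounded[M [_ /(_ (M + 1))]]; rewrite ltrDl => /(_ ltr01) gM.
exists (Num.max 1 (M + 1)) => a; rewrite le_max.
have [Ka|Ka] := pselect (K a); last by rewrite (ltW (gK _ Ka)).
by rewrite gM ?orbT//; exists a.
Qed.

Context (nu : {finite_measure set (borel (grass R n k)) -> \bar R}).

(** The real-valued transform agrees with the extended integral because the latter is finite: [psi]
    is bounded and [nu] has finite mass. *)
Lemma dual_radonE (psi : affgrass R n k -> R) x :
  continuous psi -> (forall a, 0 <= psi a) -> (exists M : R, forall a, `|psi a| <= M) ->
  (\int[nu]_H (psi (aff H x))%:E = (dual_radon nu psi x)%:E)%E.
Proof.
move=> cpsi psi0 [M psiM]; rewrite /dual_radon /Rintegral fineK//.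
have mpsi : measurable_fun [set: borel (grass R n k)] (fun H => psi (aff H x)).
  exact: (measurableT_comp (measurable_aff cpsi) (pair2_measurable (x : borel _))).
rewrite ge0_fin_numE; last by apply: integral_ge0 => H _; rewrite lee_fin.
apply: (@le_lt_trans _ _ (\int[nu]_H (cst M%:E H))%E).
  apply: ge0_le_integral => //.
  - by move=> H _; rewrite lee_fin.
  - exact/measurable_EFinP.
  - by move=> H _; rewrite lee_fin; apply: le_trans (psiM (aff H x)); exact: ler_norm.
rewrite integral_cst//= lte_mul_pinfty ?ltry//.
  by rewrite lee_fin; apply: le_trans (psiM (aff point x)); exact: normr_ge0.
by rewrite -ge0_fin_numE// fin_num_measure.
Qed.

End dual_radon.

(** * Bounds for the quotient of dual transforms *)

Lemma mulfun_continuous (T : topologicalType) (R : numFieldType) (f g : T -> R) :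
  continuous f -> continuous g -> continuous (f \* g).
Proof. by move=> cf cg x; apply: cvgM; [exact: cf|exact: cg]. Qed.

(** A null space would annihilate the Gaussian integral. Positivity is what identifies the norm of
    exponent [+oo] with the essential supremum. *)
Lemma lebRn_setT_gt0 (R : realType) n : (0 < lebRn R n setT)%E.
Proof.
rewrite lt0e measure_ge0 andbT; apply/eqP => l0.
have [c c0] := @integral_gaussRn R 1 n ltr01.
rewrite null_set_integral//.
  by move=> /eqP; rewrite eqe lt_eqF.
by apply/measurable_EFinP; exact: measurable_gaussRn.
Qed.

Section radon_bound.
Context {R : realType} {n k : nat}.
Context (nu : {finite_measure set (borel (grass R n k)) -> \bar R}).
Context (g w : affgrass R n k -> R) (gamma : R).
Hypotheses (cg : continuous g) (cw : continuous w).
Hypotheses (w0 : forall a, 0 <= w a) (g0 : forall a, 0 <= g a).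
Hypotheses (gle : forall a, g a <= gamma).
Hypothesis (wb : exists M : R, forall a, `|w a| <= M).

Let cgw : continuous (g \* w).
Proof. exact: mulfun_continuous. Qed.

Let gw0 a : 0 <= (g \* w) a. Proof. by rewrite mulr_ge0. Qed.

Let gwb : exists M : R, forall a, `|(g \* w) a| <= M.
Proof.
have [M wM] := wb; exists (gamma * M) => a.
by rewrite normrM ler_pM// ger0_norm.
Qed.

Let dw x := dual_radonE nu x cw w0 wb.
Let dgw x := dual_radonE nu x cgw gw0 gwb.

Let gamma_ge0 : 0 <= gamma.
Proof. exact: le_trans (g0 (aff point 0)) (gle _). Qed.

(** This bounds the quotient by [gamma], and shows that the numerator vanishes wherever the
    denominator does. *)
Lemma dual_radon_le x : dual_radon nu (g \* w) x <= gamma * dual_radon nu w x.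
Proof.
rewrite -lee_fin EFinM -dgw -dw -ge0_integralZl_EFin//; last 2 first.
- by move=> H _; rewrite lee_fin.
- apply/measurable_EFinP.
  exact: (measurableT_comp (measurable_aff cw) (pair2_measurable (x : borel _))).
apply: ge0_le_integral => //.
- by move=> H _; rewrite lee_fin.
- apply/measurable_EFinP.
  exact: (measurableT_comp (measurable_aff cgw) (pair2_measurable (x : borel _))).
- apply/measurable_EFinP; apply: measurable_funM => //.
  exact: (measurableT_comp (measurable_aff cw) (pair2_measurable (x : borel _))).
- by move=> H _; rewrite -EFinM lee_fin ler_wpM2r.
Qed.

Lemma dual_radon_ge0 x : 0 <= dual_radon nu w x.
Proof. by rewrite -lee_fin -dw; apply: integral_ge0 => H _; rewrite lee_fin. Qed.

Lemma dual_radonM_ge0 x : 0 <= dual_radon nu (g \* w) x.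
Proof. by rewrite -lee_fin -dgw; apply: integral_ge0 => H _; rewrite lee_fin. Qed.

Lemma radon_quotient_ge0 x : 0 <= radon_quotient nu g w x.
Proof. by rewrite divr_ge0 ?dual_radon_ge0 ?dual_radonM_ge0. Qed.

Lemma radon_quotient_le x : radon_quotient nu g w x <= gamma.
Proof.
rewrite /radon_quotient; have [->|d0] := eqVneq (dual_radon nu w x) 0.
  by rewrite invr0 mulr0.
by rewrite ler_pdivrMr ?dual_radon_le// lt_def d0 dual_radon_ge0.
Qed.

(** The quotient lies between 0 and [gamma], so its norm is a real number [M]; the essential bound
    is then restated without division. *)
Lemma Lnorm_radon_quotient : exists M : R, [/\ 0 <= M,
  Lnorm (lebesgueRn R n) +oo (fun x => (radon_quotient nu g w x)%:E) = M%:E &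
  {ae lebRn R n, forall x,
    dual_radon nu (g \* w) x <= M * dual_radon nu w x}].
Proof.
set L := Lnorm _ _ _.
have LE : L = ess_sup (lebesgueRn R n)
    (abse \o (fun x => (radon_quotient nu g w x)%:E)).
  by rewrite /L unlock; have := lebRn_setT_gt0 R n; rewrite /lebRn => ->.
have L0 : (0 <= L)%E by exact: Lnorm_ge0.
have Lle : (L <= gamma%:E)%E.
  rewrite LE; apply/ess_supP; apply: nearW => x /=.
  by rewrite lee_fin ger0_norm ?radon_quotient_ge0// radon_quotient_le.
have Lf : L \is a fin_num by rewrite ge0_fin_numE// (le_lt_trans Lle) ?ltry.
exists (fine L); split; [by rewrite fine_ge0|by rewrite fineK|].
have : {ae lebRn R n, forall x, (`|(radon_quotient nu g w x)%:E| <= L)%E}.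
  by rewrite LE; exact: (ess_sup_ge (lebesgueRn R n)).
move=> [N [mN N0 LN]]; exists N; split=> // x nx; apply: LN; apply: contra_not nx.
rewrite -{1}(fineK Lf) /= lee_fin.
rewrite ger0_norm ?radon_quotient_ge0// /radon_quotient.
(* Where the denominator is 0 the quotient is 0 by convention and carries no information; there the
   numerator is at most 0 by [dual_radon_le]. *)
have [d0 _|d0] := eqVneq (dual_radon nu w x) 0.
  by have := dual_radon_le x; rewrite d0 !mulr0.
by rewrite ler_pdivrMr// lt_def d0 dual_radon_ge0.
Qed.

(** As [e] depends on [x] only, Tonelli with [x] outermost makes the inner integral over [H] a dual
    transform, to which the almost everywhere bound applies. *)
Lemma integral_radon_le (M : R) (e : 'rV[R]_n -> R) : 0 <= M ->
  measurable_fun [set: borel 'rV[R]_n] (e : borel 'rV[R]_n -> R) ->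
  (forall x, 0 <= e x) ->
  {ae lebRn R n, forall x,
    dual_radon nu (g \* w) x <= M * dual_radon nu w x} ->
  (\int[nu \x lebRn R n]_z (g (aff z.1 z.2) * w (aff z.1 z.2) * e z.2)%:E <=
   M%:E * \int[nu \x lebRn R n]_z (w (aff z.1 z.2) * e z.2)%:E)%E.
Proof.
move=> M0 me e0 ae.
have me2 : measurable_fun [set: borel (grass R n k) * borel 'rV[R]_n]
    (fun z => e z.2) by exact: (measurableT_comp me measurable_snd).
have key (psi : affgrass R n k -> R) : continuous psi ->
    (forall a, 0 <= psi a) -> (exists M : R, forall a, `|psi a| <= M) ->
    measurable_fun [set: borel 'rV[R]_n]
      (fun x => (dual_radon nu psi x * e x)%:E) /\
    (\int[nu \x lebRn R n]_z (psi (aff z.1 z.2) * e z.2)%:E =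
     \int[lebRn R n]_x (dual_radon nu psi x * e x)%:E)%E.
  move=> cpsi psi0 psib.
  pose f (z : borel (grass R n k) * borel 'rV[R]_n) : \bar R :=
    (psi (aff z.1 z.2) * e z.2)%:E.
  have mf : measurable_fun [set: borel (grass R n k) * borel 'rV[R]_n] f.
    by apply/measurable_EFinP; apply: measurable_funM => //; exact: measurable_aff.
  have f0 z : (0 <= f z)%E by rewrite lee_fin mulr_ge0.
  have E : (fun x => (dual_radon nu psi x * e x)%:E) = fubini_G nu f.
    apply/funext => x; rewrite /fubini_G /f /= EFinM -dual_radonE//.
    rewrite -ge0_integralZr//.
    - apply/measurable_EFinP.
      exact: (measurableT_comp (measurable_aff cpsi) (pair2_measurable (x : borel _))).
    - by move=> H _; rewrite lee_fin.
    - by rewrite lee_fin.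
  rewrite E; split; first exact: measurable_fun_fubini_tonelli_G.
  rewrite -[LHS]/(\int[nu \x lebRn R n]_z f z)%E (fubini_tonelli2 f mf f0).
  by rewrite -E.
have [mgw Egw] := key _ cgw gw0 gwb; have [mw Ew] := key _ cw w0 wb.
rewrite [leLHS]Egw Ew -ge0_integralZl_EFin//; last first.
  by move=> x _; rewrite lee_fin mulr_ge0 ?dual_radon_ge0.
apply: ae_ge0_le_integral => //.
- by move=> x _; rewrite lee_fin mulr_ge0 ?dual_radonM_ge0.
- by move=> x _; rewrite -EFinM lee_fin !mulr_ge0 ?dual_radon_ge0.
- exact: measurable_funeM.
case: ae => N [mN N0 sN]; exists N; split=> // x nx; apply: sN.
apply: contra_not nx => /= Hx _; rewrite -EFinM lee_fin mulrA.
by rewrite ler_wpM2r.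
Qed.

End radon_bound.

(** * Transfer to the product of the Grassmannian with R^n, and conclusion *)

Section main_inequality.
Context {R : realType} {n k : nat}.
Context (nu : {finite_measure set (borel (grass R n k)) -> \bar R}).

(** A Gaussian in the component of [x] inside [H]. *)
Definition perp_gauss (b : R) (z : grass R n k * 'rV[R]_n) : R :=
  gaussRn b (z.2 - perp_proj (grass_vspace z.1) z.2).

Lemma measurable_perp_gauss (b : R) :
  measurable_fun [set: borel (grass R n k) * borel 'rV[R]_n] (perp_gauss b).
Proof.
apply: (@continuous_prod_measurable R (grass R n k) 'rV[R]_n (perp_gauss b)).
- exact: second_countable_grass.
- exact: second_countable_mx.
apply: continuous_gaussRn_comp => z.
by apply: cvgB; [exact: cvg_snd|exact: continuous_perp_proj_grass].
Qed.

Lemma measurable_gauss_perp (b : R) :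
  measurable_fun [set: borel (grass R n k) * borel 'rV[R]_n]
    (fun z => gaussRn b (perp_proj (grass_vspace z.1) z.2)).
Proof.
apply: (@continuous_prod_measurable R (grass R n k) 'rV[R]_n
  (fun z => gaussRn b (perp_proj (grass_vspace z.1) z.2))).
- exact: second_countable_grass.
- exact: second_countable_mx.
by apply: continuous_gaussRn_comp; exact: continuous_perp_proj_grass.
Qed.

(** Pythagoras: the product of the two Gaussians no longer depends on [H]. *)
Lemma gauss_perpM (b : R) (H : grass R n k) (x : 'rV[R]_n) :
  perp_gauss b (H, x) * gaussRn b (perp_proj (grass_vspace H) x) = gaussRn b x.
Proof.
have [pP xP] := xgetPex 0 (perp_decomposition (grass_vspace H) x).
rewrite -/(perp_proj (grass_vspace H) x) in pP xP.
rewrite /perp_gauss /gaussRn /= -expRD; congr expR.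
rewrite -mulrDr; congr (_ * _).
rewrite -[in RHS](subrK (perp_proj (grass_vspace H) x) x).
move: (perp_proj (grass_vspace H) x) pP xP => v vP; move: (x - v) => u uP.
by rewrite !dotrDl !dotrDr (dotrC u v) (vP u uP) addr0 add0r.
Qed.

(** On each [H] the weight [c^-1 * perp_gauss b] has integral 1 along [H], so inserting it extends
    the integral over the complement to all of R^n, with a jointly measurable integrand. *)
Lemma integral_haar_perp (b c : R) (psi : affgrass R n k -> R) :
  (k <= n)%N -> 0 < c ->
  (\int[lebRn R (n - k)]_z (gaussRn b z)%:E = c%:E)%E ->
  measurable_fun [set: borel (grass R n k) * borel 'rV[R]_n]
    (fun z => psi (aff z.1 z.2)) ->
  (forall a, 0 <= psi a) ->
  (\int[nu]_H integral_perp H (fun z => (psi (aff H z))%:E) =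
   \int[nu \x lebRn R n]_z (psi (aff z.1 z.2) * (c^-1 * perp_gauss b z))%:E)%E.
Proof.
move=> kn c0 cE mpsi psi0.
pose f (z : borel (grass R n k) * borel 'rV[R]_n) : \bar R :=
  (psi (aff z.1 z.2) * (c^-1 * perp_gauss b z))%:E.
have c'0 : 0 <= c^-1 by rewrite invr_ge0 ltW.
have mf : measurable_fun [set: borel (grass R n k) * borel 'rV[R]_n] f.
  apply/measurable_EFinP; apply: measurable_funM => //.
  by apply: measurable_funM => //; exact: measurable_perp_gauss.
have f0 z : (0 <= f z)%E by rewrite lee_fin !mulr_ge0// gaussRn_ge0.
rewrite -[RHS]/(\int[nu \x lebRn R n]_z f z)%E (fubini_tonelli1 f mf f0).
apply: eq_integral => H _; rewrite /fubini_F /f /=.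
pose F (z : borel 'rV[R]_n) := (psi (aff H z))%:E.
have mF : measurable_fun [set: borel 'rV[R]_n] F.
  apply/measurable_EFinP.
  exact: (measurableT_comp mpsi (pair1_measurable (H : borel _))).
have F0 x : (0 <= F x)%E by rewrite lee_fin.
have := integral_perpE H kn (ltW c0) cE mF F0.
move=> /(congr1 (fun t => t * c^-1%:E)%E); rewrite -muleA -EFinM divff ?gt_eqF// mule1.
rewrite -/F => <-.
rewrite -ge0_integralZr//; first last.
- by move=> x _; rewrite mule_ge0 ?lee_fin ?gaussRn_ge0.
- exact: measurable_perp_weight.
apply: eq_integral => x _; rewrite /F aff_perp_proj -!EFinM; congr EFin.
by rewrite /perp_gauss /=; ring.
Qed.
End main_inequality.

Lemma finite_measure_main (R : realType) (n k : nat) (p : R)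
    (nu : {finite_measure set (borel (grass R n k)) -> \bar R})
    (w g : affgrass R n k -> R) (alpha beta gamma : R) :
  (k <= n)%N -> 1 < p ->
  C0 w -> (aff_Lnorm nu 1 (cst 1%R) w < +oo)%E -> (forall a, 0 <= w a) ->
  C0 g -> (aff_Lnorm nu p w g < +oo)%E ->
  0 < alpha -> 0 < beta -> 0 < gamma ->
  (forall a : affgrass R n k,
     beta * expR (- alpha * enorm (val a).2 ^+ 2) <= g a /\
     g a <= gamma * expR (- alpha * enorm (val a).2 ^+ 2)) ->
  (aff_Lnorm nu p w g <=
   ((gamma / beta) `^ (p - 1))%:E *
   Lnorm (lebesgueRn R n) +oo (fun x => (radon_quotient nu g w x)%:E) *
   aff_Lnorm nu 1 (cst 1%R) w `^ p^-1)%E.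
Proof.
move=> kn p1 Cw wfin w0 Cg gfin a0 b0 c0 gab.
have p0 : 0 < p by lra.
have p10 : 0 < p - 1 by lra.
have [cg _] := Cg; have [cw _] := Cw.
have g0 a : 0 < g a.
  by apply: lt_le_trans (gab a).1; rewrite mulr_gt0 ?expR_gt0.
have gle a : g a <= gamma.
  apply: (le_trans (gab a).2); rewrite ler_piMr ?(ltW c0)//.
  by rewrite -expR0 ler_expR mulNr oppr_le0 mulr_ge0 ?sqr_ge0 ?(ltW a0).
(* With this [b], the power [(p - 1)^-1] of [e] below is exactly [e^(-alpha |z|^2)]. *)
pose b := alpha * (p - 1).
have bgt0 : 0 < b by rewrite mulr_gt0.
have [c cgt0 cE] := @integral_gaussRn R b (n - k) bgt0.
pose G (z : borel (grass R n k) * borel 'rV[R]_n) := g (aff z.1 z.2).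
pose u (z : borel (grass R n k) * borel 'rV[R]_n) :=
  w (aff z.1 z.2) * (c^-1 * perp_gauss b z).
pose e (z : borel (grass R n k) * borel 'rV[R]_n) :=
  gaussRn b (perp_proj (grass_vspace z.1) z.2).
have mG := measurable_aff cg; have mW := measurable_aff cw.
have mu : measurable_fun setT u.
  apply: measurable_funM => //; apply: measurable_funM => //.
  exact: measurable_perp_gauss.
have LE : (aff_Lnorm nu p w g =
    (\int[nu \x lebRn R n]_z (G z `^ p * u z)%:E) `^ p^-1)%E.
  rewrite /aff_Lnorm; congr (_ `^ _)%E.
  rewrite (integral_haar_perp (b := b) (c := c) nu
    (psi := fun a => `|g a| `^ p * w a))//; first last.
  - by move=> a; rewrite mulr_ge0 ?powR_ge0.
  - apply: measurable_funM => //.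
    apply: (measurableT_comp (measurable_powR p)).
    exact: measurableT_comp mG.
  by apply: eq_integral => z _; rewrite gtr0_norm// /u mulrA.
have NE : (aff_Lnorm nu 1 (cst 1%R) w = \int[nu \x lebRn R n]_z (u z)%:E)%E.
  rewrite /aff_Lnorm invr1 poweRe1; last first.
    apply: integral_ge0 => H _; apply: integral_ge0 => y _.
    by rewrite lee_fin mulr_ge0 ?powR_ge0.
  rewrite (integral_haar_perp (b := b) (c := c) nu
    (psi := fun a => `|w a| `^ 1 * cst 1 a))//; first last.
  - by move=> a; rewrite mulr_ge0 ?powR_ge0.
  - apply: measurable_funM => //; apply: (measurableT_comp (measurable_powR 1)).
    exact: measurableT_comp mW.
  by apply: eq_integral => z _; rewrite /= powRr1// mulr1 ger0_norm.
have wb := C0_bounded Cw.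
have [M [M0 ME Mae]] := Lnorm_radon_quotient nu cg cw w0 (fun a => ltW (g0 a)) gle wb.
rewrite ME LE NE -EFinM.
have eE z : e z `^ (p - 1)^-1 = expR (- alpha * enorm (val (aff z.1 z.2)).2 ^+ 2).
  rewrite /e /gaussRn -expRM sqr_enorm /=; congr expR.
  by rewrite /b; field; lra.
apply: (hoelder_self_bound (e := e)) => //.
- exact: measurable_gauss_perp.
- by move=> z; exact: g0.
- by move=> z; rewrite /u !mulr_ge0 ?invr_ge0 ?(ltW cgt0) ?gaussRn_ge0.
- by move=> z; exact: gaussRn_ge0.
- by move=> z; rewrite eE; exact: (gab _).1.
- by move=> z; rewrite eE; exact: (gab _).2.
(* By Pythagoras the Gaussian factors of [u] and [e] combine into one depending on [x] alone, as
   [integral_radon_le] demands. *)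
- have ue z : u z * e z = w (aff z.1 z.2) * (c^-1 * gaussRn b z.2).
    by case: z => H x; rewrite /u /e /= -!mulrA gauss_perpM.
  under eq_integral do rewrite -mulrA ue mulrA.
  under [in leRHS]eq_integral do rewrite ue.
  apply: (integral_radon_le cg cw w0 (fun a => ltW (g0 a)) gle wb
    (e := fun x => c^-1 * gaussRn b x)) => //.
    by apply: measurable_funM => //; exact: measurable_gaussRn.
  by move=> x; rewrite mulr_ge0 ?invr_ge0 ?(ltW cgt0) ?gaussRn_ge0.
- apply: (lty_poweRy (r := p^-1)); first by rewrite invr_eq0 gt_eqF.
  by rewrite -LE.
- by rewrite -NE.
Qed.

Theorem theorem2p4 (R : realType) (n k : nat) (p : R)
    (nu : {measure set (borel (grass R n k)) -> \bar R})
    (w g : affgrass R n k -> R) (alpha beta gamma : R) :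
  (0 < k < n)%N -> 1 < p -> is_haar nu ->
  C0 w -> (aff_Lnorm nu 1 (cst 1%R) w < +oo)%E -> (forall a, 0 <= w a) ->
  C0 g -> (aff_Lnorm nu p w g < +oo)%E ->
  0 < alpha -> 0 < beta -> 0 < gamma ->
  (forall a : affgrass R n k,
     beta * expR (- alpha * enorm (val a).2 ^+ 2) <= g a /\
     g a <= gamma * expR (- alpha * enorm (val a).2 ^+ 2)) ->
  (aff_Lnorm nu p w g <=
   ((gamma / beta) `^ (p - 1))%:E *
   Lnorm (lebesgueRn R n) +oo (fun x => (radon_quotient nu g w x)%:E) *
   aff_Lnorm nu 1 (cst 1%R) w `^ p^-1)%E.
Proof.
move=> /andP[_ kn] p1 nuH.
(* The prescribed total mass is a real number, so the Haar measure is finite. *)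
have nu_fin : fin_num_fun nu.
  by apply: lty_fin_num_fun; rewrite (haar_mass nuH) ltry.
exact: (@finite_measure_main R n k p (finmeas nu_fin) w g alpha beta gamma
  (ltnW kn) p1).
Qed.
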